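(* Let $\varphi_e(z):=e^z$ for $z\in\mathbb{D}$, let $\varphi_{Ne}(z):=1+z-z^3/3$, let $p\in\mathcal{H}$ satisfy $p(0)=1$, and let $\beta\in\mathbb{R}$. If any one of the following differential subordinations holds, then $p\prec\varphi_{Ne}$: (a) $1+\beta zp'(z)\prec\varphi_e(z)$, for $\beta\geq\displaystyle\sum_{n=1}^{\infty}\frac{3}{2n\,(n!)}\approx1.97685$; (b) $1+\beta\,\dfrac{zp'(z)}{p(z)}\prec\varphi_e(z)$, for $\beta\geq\dfrac{1}{\log(5/3)}\displaystyle\sum_{n=1}^{\infty}\frac{1}{n\,(n!)}\approx2.57995$; (c) $1+\beta\,\dfrac{zp'(z)}{p^2(z)}\prec\varphi_e(z)$, for $\beta\geq\displaystyle\sum_{n=1}^{\infty}\frac{5}{2n\,(n!)}\approx3.29476$. Each estimate on $\beta$ is sharp.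
   Context: $\mathbb{D}=\{z\in\mathbb{C}:|z|<1\}$ and $\mathcal{H}$ is the set of all analytic functions on $\mathbb{D}$. For $f,g\in\mathcal{H}$, $f\prec g$ ($f$ is subordinate to $g$) means that there is $w\in\mathcal{H}$ with $w(0)=0$ and $|w(z)|<1$ for $z\in\mathbb{D}$ such that $f(z)=g(w(z))$ on $\mathbb{D}$; in particular, writing a subordination presupposes that both sides are analytic in $\mathbb{D}$. $\log$ of a positive number is the natural logarithm. That an estimate $\beta\ge\beta_0$ is sharp means that $\beta_0$ cannot be replaced by any smaller real number so that the implication remains valid for all such $p$ and all $\beta$ at least that number. *)

(* Defs.v *)
From Stdlib Require Import Reals Factorial.
From Coquelicot Require Import Coquelicot.
Open Scope R_scope.

(* The open unit disk. *)
Definition in_D (z : C) : Prop := Cmod z < 1.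

(* Functions on the disk are total functions C -> C of which only the values on
   the disk matter; analytic means complex differentiable at every point. *)
Definition analytic_on_D (f : C -> C) : Prop :=
  forall z : C, in_D z -> ex_derive (K := C_AbsRing) (V := C_NormedModule) f z.

Definition subordinate (f g : C -> C) : Prop :=
  analytic_on_D f /\ analytic_on_D g /\
  exists w : C -> C,
    analytic_on_D w /\ w (RtoC 0) = RtoC 0 /\
    (forall z : C, in_D z -> Cmod (w z) < 1) /\
    (forall z : C, in_D z -> f z = g (w z)).

(* exp (x + i y) = exp x * (cos y + i sin y); Coquelicot has no complex
   exponential. *)
Definition Cexp (z : C) : C :=
  (exp (Re z) * cos (Im z), exp (Re z) * sin (Im z)).

Definition phi_e (z : C) : C := Cexp z.

Definition phi_Ne (z : C) : C := (1 + z - z ^ 3 / 3)%C.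

(* [C_derive] is total, and is the complex derivative wherever the function is
   complex differentiable. *)
Definition dsub_a (beta : R) (p : C -> C) : Prop :=
  subordinate (fun z => (1 + beta * (z * C_derive p z))%C) phi_e.

(* Division in C is total.  The quotients in [dsub_b] and [dsub_c] are meant as honest
   functions on the disk, hence the condition that p has no zero there: as
   p 0 = 1, a zero of p would be a pole of the quotient, so this is what the
   analyticity of the left-hand side presupposes. *)
Definition dsub_b (beta : R) (p : C -> C) : Prop :=
  (forall z : C, in_D z -> p z <> RtoC 0) /\
  subordinate (fun z => (1 + beta * (z * C_derive p z / p z))%C) phi_e.

Definition dsub_c (beta : R) (p : C -> C) : Prop :=
  (forall z : C, in_D z -> p z <> RtoC 0) /\
  subordinate (fun z => (1 + beta * (z * C_derive p z / p z ^ 2))%C) phi_e.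

(* [Series a] sums a from index 0, so the n-th term of the mathematical series
   is the term of index n - 1 here. *)
Definition beta_a : R :=
  Series (fun n => 3 / (2 * INR (S n) * INR (fact (S n)))).

Definition beta_b : R :=
  1 / ln (5 / 3) * Series (fun n => 1 / (INR (S n) * INR (fact (S n)))).

Definition beta_c : R :=
  Series (fun n => 5 / (2 * INR (S n) * INR (fact (S n)))).

Definition implication_from (dsub : R -> (C -> C) -> Prop) (b : R) : Prop :=
  forall (p : C -> C) (beta : R),
    analytic_on_D p -> p (RtoC 0) = RtoC 1 ->
    b <= beta -> dsub beta p -> subordinate p phi_Ne.

Definition sharp (dsub : R -> (C -> C) -> Prop) (b0 : R) : Prop :=
  forall b : R, b < b0 -> ~ implication_from dsub b.

(* x rounded to five decimals is y. *)
Definition approx5 (x y : R) : Prop := Rabs (x - y) <= 5 / 10 ^ 6.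

(* Main.v *)
(* In each of the three cases write the left-hand side as [exp (w z)] with a Schwarz
   function [w].  The Schwarz lemma bounds the modulus of [beta z p'], [beta z p' / p] or
   [beta z (1 / p)'] by [exp |z| - 1], and integrating along the ray from [0] to [z] gives
   [|p z - 1| <= E / beta], [|p z - 1| <= exp (E / beta) - 1] or [|1 / p z - 1| <= E / beta],
   where [E = Ein |z|] and [Ein x = sum x^n / (n n!)] is strictly below [Ein 1].  The
   constants are exactly those for which [p] then takes its values in the disk
   [|u - 1| < 2 / 3].  As [|w^3 / 3 - w| >= 2 / 3] on the unit circle, that disk lies in the
   univalent image of [phi_Ne].

   Sharpness is witnessed by the solutions with [w z = z], namely [1 + Ein / beta],
   [exp (Ein / beta)] and [1 / (1 - Ein / beta)]: for a smaller [beta] they exceed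
   [phi_Ne 1 = 5 / 3] at some real point of the disk.

   Analyticity is plain complex differentiability, so the Schwarz lemma is obtained from the
   mean value property on circles, which is Goursat's theorem on a square of side [2 PI] in
   logarithmic coordinates. *)
Require Import Defs.
From Stdlib Require Import Reals Factorial Lra Lia ClassicalEpsilon Classical.
From Coquelicot Require Import Coquelicot.
Open Scope R_scope.

(** * Complex differentiation *)

(** Derivatives are not known to be continuous, which is why Goursat's bisection appears. The
    logarithmic coordinates [a + exp (s + i t)] never reach the centre [a], so the mean value
    property asks for differentiability off [a] and continuity at [a]; this covers [w z / z] at its
    removable singularity. Adding a multiple of [|z|^2] makes the maximum principle strict: one
    small circle around a maximiser already gives a contradiction.

    Integration along rays takes the form of a mean value inequality: a curve whose speed is at most
    [g'] moves no further than [g] grows. In case (b) a Gronwall estimate for [|p|] stands in for a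
    logarithm of [p].

    The factorisation of [phi_Ne a - phi_Ne b] by [a - b] drives the nephroid part: it gives
    injectivity, the contraction behind surjectivity onto the disk, and the derivative of the
    inverse.

    For sharpness the complex [Ein] is an integral over [[0, 1]], differentiated under the integral
    sign by means of a quadratic bound on the remainder of [exp]. *)

Notation is_C_derive := (@is_derive C_AbsRing C_NormedModule).

Definition C_continuous (f : C -> C) (z : C) : Prop :=
  forall eps, 0 < eps -> exists d, 0 < d /\
    forall y, Cmod (y - z) < d -> Cmod (f y - f z) < eps.

(** [C] carries two module structures over itself. The product and identity rules live on the
    second, while [analytic_on_D] uses the first; the limit clauses are convertible and only
    linearity has to be proved again. *)
Lemma is_C_derive_AbsRing (f : C -> C) z l :
  is_C_derive f z l <->
  is_derive (K := C_AbsRing) (V := AbsRing_NormedModule C_AbsRing) f z l.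
Proof.
  split; intros [H1 H2]; (split; [apply is_linear_scal_l | exact H2]).
Qed.

Lemma is_C_derive_eps (f : C -> C) z l :
  is_C_derive f z l <->
  forall eps, 0 < eps -> exists d, 0 < d /\ forall y, Cmod (y - z) < d ->
    Cmod (f y - f z - (y - z) * l) <= eps * Cmod (y - z).
Proof.
  split.
  - intros [_ H] eps Heps.
    destruct (H z (fun P HP => HP) (mkposreal eps Heps)) as [d Hd].
    exists d; split; [apply cond_pos|]. intros y Hy. apply (Hd y). exact Hy.
  - intros H. split; [apply is_linear_scal_l|]. intros x Hx.
    rewrite <- (is_filter_lim_locally_unique (K := C_AbsRing)
                  (V := AbsRing_NormedModule C_AbsRing) _ _ Hx).
    intros eps. destruct (H eps (cond_pos eps)) as [d [Hd H']].
    exists (mkposreal d Hd). intros y Hy. apply (H' y). exact Hy.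
Qed.

Lemma is_C_derive_const (a : C) z : is_C_derive (fun _ => a) z (RtoC 0).
Proof. apply (is_derive_const (K := C_AbsRing) a z). Qed.

Lemma is_C_derive_id z : is_C_derive (fun x => x) z (RtoC 1).
Proof. apply is_C_derive_AbsRing, (is_derive_id (K := C_AbsRing)). Qed.

Lemma is_C_derive_plus (f g : C -> C) z a b :
  is_C_derive f z a -> is_C_derive g z b ->
  is_C_derive (fun x => f x + g x)%C z (a + b)%C.
Proof. apply (is_derive_plus (K := C_AbsRing) f g z a b). Qed.

Lemma is_C_derive_minus (f g : C -> C) z a b :
  is_C_derive f z a -> is_C_derive g z b ->
  is_C_derive (fun x => f x - g x)%C z (a - b)%C.
Proof. apply (is_derive_minus (K := C_AbsRing) f g z a b). Qed.

Lemma is_C_derive_mult (f g : C -> C) z a b :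
  is_C_derive f z a -> is_C_derive g z b ->
  is_C_derive (fun x => f x * g x)%C z (a * g z + f z * b)%C.
Proof.
  intros H1 H2. apply is_C_derive_AbsRing. apply is_C_derive_AbsRing in H1, H2.
  apply (is_derive_mult (K := C_AbsRing) f g z a b H1 H2 Cmult_comm).
Qed.

Lemma is_C_derive_comp (f g : C -> C) z a b :
  is_C_derive f (g z) a -> is_C_derive g z b ->
  is_C_derive (fun x => f (g x)) z (b * a)%C.
Proof.
  intros H1 H2. apply is_C_derive_AbsRing in H2.
  apply (is_derive_comp (K := C_AbsRing) f g z a b H1 H2).
Qed.

Lemma is_C_derive_eq (f : C -> C) (z a b : C) : is_C_derive f z a -> a = b -> is_C_derive f z b.
Proof. intros H <-; exact H. Qed.

Lemma is_C_derive_ext (f g : C -> C) z l :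
  (forall y, f y = g y) -> is_C_derive f z l -> is_C_derive g z l.
Proof. apply (is_derive_ext (K := C_AbsRing) f g z l). Qed.

Lemma is_C_derive_ext_near (f g : C -> C) z l r : 0 < r ->
  (forall y, Cmod (y - z) < r -> f y = g y) ->
  is_C_derive f z l -> is_C_derive g z l.
Proof.
  intros Hr H. apply (is_derive_ext_loc (K := C_AbsRing) f g z l).
  exists (mkposreal r Hr). intros y Hy. apply H. exact Hy.
Qed.

Lemma is_C_derive_continuous (f : C -> C) z l : is_C_derive f z l -> C_continuous f z.
Proof.
  intros H eps Heps. rewrite is_C_derive_eps in H.
  destruct (H 1 Rlt_0_1) as [d [Hd H1]].
  assert (Hl := Cmod_ge_0 l).
  exists (Rmin d (eps / (2 + Cmod l))). split.
  { apply Rmin_pos; [lra|]. apply Rdiv_lt_0_compat; lra. }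
  intros y Hy. assert (Hy1 := Rlt_le_trans _ _ _ Hy (Rmin_l _ _)).
  assert (Hy2 := Rlt_le_trans _ _ _ Hy (Rmin_r _ _)).
  specialize (H1 y Hy1).
  replace (f y - f z)%C with ((f y - f z - (y - z) * l) + (y - z) * l)%C by ring.
  eapply Rle_lt_trans; [apply Cmod_triangle|]. rewrite Cmod_mult.
  apply (Rmult_lt_compat_r (2 + Cmod l)) in Hy2; [|lra].
  unfold Rdiv in Hy2. rewrite Rmult_assoc, Rinv_l in Hy2 by lra.
  assert (H0 := Cmod_ge_0 (y - z)). nra.
Qed.

Lemma is_C_derive_inv (f : C -> C) z l :
  is_C_derive f z l -> f z <> RtoC 0 ->
  is_C_derive (fun x => / f x)%C z (- l / f z ^ 2)%C.
Proof.
  intros Hf Hz.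
  assert (Hi : is_C_derive (fun x => / x)%C (f z) (- / f z ^ 2)%C).
  2:{ eapply is_C_derive_eq; [apply (is_C_derive_comp _ _ _ _ _ Hi Hf)|]. field. exact Hz. }
  set (a := f z) in *. clearbody a. clear f Hf z l.
  apply is_C_derive_eps. intros eps Heps.
  assert (Ha : 0 < Cmod a) by (apply Cmod_gt_0; exact Hz).
  (* The remainder is [(y - a)^2 / (y a^2)]. The first bound keeps [|y| > |a| / 2]; the second then
     gives [|y - a| <= eps |a|^2 |y|]. *)
  exists (Rmin (Cmod a / 2) (eps * Cmod a ^ 3 / 2)). split.
  { apply Rmin_pos; [lra|]. apply Rdiv_lt_0_compat; [|lra]. apply Rmult_lt_0_compat; [lra|].
    now apply pow_lt. }
  intros y Hy. assert (Hy1 := Rlt_le_trans _ _ _ Hy (Rmin_l _ _)).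
  assert (Hy2 := Rlt_le_trans _ _ _ Hy (Rmin_r _ _)).
  assert (Hy0 : Cmod a / 2 < Cmod y).
  { assert (Ht := Cmod_triangle y (- (y - a))).
    rewrite Cmod_opp in Ht. replace (y + - (y - a))%C with a in Ht by ring. lra. }
  assert (Hyn : y <> RtoC 0) by (apply Cmod_gt_0; lra).
  replace (/ y - / a - (y - a) * - / a ^ 2)%C with ((y - a) * (y - a) / (y * a ^ 2))%C
    by (field; split; assumption).
  assert (Hn : 0 < Cmod (y * a ^ 2)).
  { rewrite Cmod_mult, Cmod_pow. apply Rmult_lt_0_compat; [lra|now apply pow_lt]. }
  rewrite Cmod_div, !Cmod_mult by (apply Cmod_gt_0; exact Hn).
  rewrite Cmod_pow.
  assert (H0 := Cmod_ge_0 (y - a)).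
  apply Rle_div_l; [rewrite Cmod_mult, Cmod_pow in Hn; exact Hn|].
  replace (eps * Cmod (y - a) * (Cmod y * Cmod a ^ 2))
    with (Cmod (y - a) * (eps * Cmod a ^ 2 * Cmod y)) by ring.
  apply Rmult_le_compat_l; [lra|].
  assert (eps * Cmod a ^ 2 * (Cmod a / 2) <= eps * Cmod a ^ 2 * Cmod y).
  { apply Rmult_le_compat_l; [|lra]. apply Rmult_le_pos; [lra|]. apply pow_le; lra. }
  simpl in *. nra.
Qed.

Ltac C_derive_rules :=
  lazymatch goal with
  | |- is_C_derive (fun x => Cplus (@?f x) (@?g x)) _ _ =>
      apply (is_C_derive_plus f g); C_derive_rules
  | |- is_C_derive (fun x => Cminus (@?f x) (@?g x)) _ _ =>
      apply (is_C_derive_minus f g); C_derive_rules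
  | |- is_C_derive (fun x => Cmult (@?f x) (@?g x)) _ _ =>
      apply (is_C_derive_mult f g); C_derive_rules
  | |- is_C_derive (fun x => x) _ _ => apply is_C_derive_id
  | |- is_C_derive (fun _ => ?a) _ _ => apply (is_C_derive_const a)
  | |- _ => idtac
  end.

Lemma Cmod_le_2 (z : C) h : Rabs (Re z) <= h -> Rabs (Im z) <= h -> Cmod z <= 2 * h.
Proof.
  intros H1 H2. eapply Rle_trans; [apply Cmod_2Rmax|].
  assert (Hs : sqrt 2 <= 2).
  { apply Rle_trans with (sqrt (2 ^ 2)); [apply sqrt_le_1_alt; lra|].
    right; apply sqrt_pow2; lra. }
  apply Rmult_le_compat; [apply sqrt_pos| |exact Hs|now apply Rmax_lub].
  eapply Rle_trans; [apply Rabs_pos|apply Rmax_l].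
Qed.

(** The real Jacobian is the matrix of multiplication by [l]; its shape is the Cauchy-Riemann
    equations, which Goursat's theorem consumes. *)
Lemma is_C_derive_differentiable (f : C -> C) x y l : is_C_derive f (x, y) l ->
  differentiable_pt_lim (fun u v => Re (f (u, v))) x y (Re l) (- Im l) /\
  differentiable_pt_lim (fun u v => Im (f (u, v))) x y (Im l) (Re l).
Proof.
  intros H. rewrite is_C_derive_eps in H.
  assert (Hk : forall eps : posreal, locally_2d (fun u v =>
    Cmod (f (u, v) - f (x, y) - ((u, v) - (x, y)) * l) <=
      eps * Rmax (Rabs (u - x)) (Rabs (v - y))) x y).
  { intros eps. assert (He := cond_pos eps).
    destruct (H (eps / 2)) as [d [Hd H1]]; [lra|].
    assert (Hd2 : 0 < d / 2) by lra. exists (mkposreal _ Hd2).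
    intros u v Hu Hv. simpl in Hu, Hv.
    assert (Hm : Cmod ((u, v) - (x, y)) <= 2 * Rmax (Rabs (u - x)) (Rabs (v - y))).
    { apply Cmod_le_2; [apply Rmax_l|apply Rmax_r]. }
    assert (Hmax : Rmax (Rabs (u - x)) (Rabs (v - y)) < d / 2) by now apply Rmax_lub_lt.
    eapply Rle_trans; [apply H1; lra|].
    nra. }
  split; intros eps; destruct (Hk eps) as [d Hd]; exists d; intros u v Hu Hv;
    specialize (Hd u v Hu Hv).
  - eapply Rle_trans; [|exact Hd].
    eapply Rle_trans; [|apply re_le_Cmod]. right. f_equal.
    destruct l, (f (u, v)), (f (x, y)); simpl. ring.
  - eapply Rle_trans; [|exact Hd].
    eapply Rle_trans; [|apply (Rle_trans _ _ _ (Rmax_r _ _) (Rmax_Cmod _))]. right. f_equal.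
    destruct l, (f (u, v)), (f (x, y)); simpl. ring.
Qed.

(** * Derivatives along real curves and a mean value inequality *)

Definition curve_derive (c : R -> C) (t : R) (l : C) : Prop :=
  is_derive (fun t => Re (c t)) t (Re l) /\ is_derive (fun t => Im (c t)) t (Im l).

Lemma curve_derive_comp (f : C -> C) (c : R -> C) t a l :
  is_C_derive f (c t) l -> curve_derive c t a ->
  curve_derive (fun t => f (c t)) t (a * l)%C.
Proof.
  intros Hf [H1 H2]. rewrite (surjective_pairing (c t)) in Hf.
  destruct (is_C_derive_differentiable _ _ _ _ Hf) as [D1 D2].
  apply is_derive_Reals in H1. apply is_derive_Reals in H2. split; apply is_derive_Reals.
  - replace (Re (a * l)) with (Re l * Re a + - Im l * Im a) by (destruct a, l; simpl; ring).
    apply (derivable_pt_lim_ext (fun t => Re (f (Re (c t), Im (c t))))).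
    { intros u. now destruct (c u). }
    apply (derivable_pt_lim_comp_2d _ _ _ _ _ _ _ _ D1 H1 H2).
  - replace (Im (a * l)) with (Im l * Re a + Re l * Im a) by (destruct a, l; simpl; ring).
    apply (derivable_pt_lim_ext (fun t => Im (f (Re (c t), Im (c t))))).
    { intros u. now destruct (c u). }
    apply (derivable_pt_lim_comp_2d _ _ _ _ _ _ _ _ D2 H1 H2).
Qed.

Lemma curve_derive_ray (z : C) t : curve_derive (fun t => RtoC t * z)%C t z.
Proof. destruct z as [x y]. split; simpl; auto_derive; trivial; ring. Qed.

Lemma mean_value_le (h h' : R -> R) :
  (forall t, 0 <= t <= 1 -> is_derive h t (h' t)) -> (forall t, 0 < t < 1 -> 0 <= h' t) ->
  h 0 <= h 1.
Proof.
  intros Hd Hp. destruct (MVT_cor2 h h' 0 1) as [c [E Hc]]; [lra| |].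
  - intros t Ht. now apply is_derive_Reals, Hd.
  - specialize (Hp c Hc). lra.
Qed.

Lemma Cmod_le_minus_plus (a b : C) : Cmod a <= Cmod (a - b) + Cmod b.
Proof. replace a with (a - b + b)%C at 1 by ring. apply Cmod_triangle. Qed.

Lemma Cmod_minus_Cmod_le (a b : C) : Rabs (Cmod a - Cmod b) <= Cmod (a - b).
Proof.
  assert (H1 := Cmod_le_minus_plus a b). assert (H2 := Cmod_le_minus_plus b a).
  rewrite <- (Cmod_opp (b - a)) in H2. replace (- (b - a))%C with (a - b)%C in H2 by ring.
  apply Rabs_le; lra.
Qed.

Lemma Re_Cconj_mult_le (a b : C) : Re a * Re b + Im a * Im b <= Cmod a * Cmod b.
Proof.
  rewrite <- (Cmod_conj a), <- Cmod_mult.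
  eapply Rle_trans; [|apply re_le_Cmod]. eapply Rle_trans; [|apply Rle_abs].
  right. destruct a, b; simpl; ring.
Qed.

(* Project onto the direction of the chord [c 1 - c 0] and apply the real mean value theorem. *)
Lemma curve_mean_value (c c' : R -> C) (g g' : R -> R) :
  (forall t, 0 <= t <= 1 -> curve_derive c t (c' t)) ->
  (forall t, 0 <= t <= 1 -> is_derive g t (g' t)) ->
  (forall t, 0 < t < 1 -> Cmod (c' t) <= g' t) ->
  Cmod (c 1 - c 0) <= g 1 - g 0.
Proof.
  intros Hc Hg H. set (e := (c 1 - c 0)%C).
  (* This settles the case of a zero chord, where the projection carries no information. *)
  assert (H1 : g 0 <= g 1).
  { apply (mean_value_le g g'); trivial. intros t Ht.
    eapply Rle_trans; [apply Cmod_ge_0|now apply H]. }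
  assert (H2 : Cmod e * g 0 - (Re e * Re (c 0) + Im e * Im (c 0)) <=
          Cmod e * g 1 - (Re e * Re (c 1) + Im e * Im (c 1))).
  { apply (mean_value_le (fun t => Cmod e * g t - (Re e * Re (c t) + Im e * Im (c t)))
      (fun t => Cmod e * g' t - (Re e * Re (c' t) + Im e * Im (c' t)))).
    - intros t Ht. destruct (Hc t Ht) as [D1 D2].
      apply (is_derive_minus (K := R_AbsRing) (V := R_NormedModule)).
      { apply is_derive_scal, Hg, Ht. }
      apply (is_derive_plus (K := R_AbsRing) (V := R_NormedModule));
        apply is_derive_scal; assumption.
    - intros t Ht. specialize (H t Ht). assert (Hr := Re_Cconj_mult_le e (c' t)).
      assert (H0 := Cmod_ge_0 e). nra. }
  assert (H3 : Cmod e ^ 2 = Re e * (Re (c 1) - Re (c 0)) + Im e * (Im (c 1) - Im (c 0))).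
  { rewrite Cmod2_alt. unfold e. destruct (c 1), (c 0); simpl. ring. }
  destruct (Cmod_ge_0 e) as [H0|H0]; [|rewrite <- H0; lra]. nra.
Qed.

(** * The complex exponential *)

Lemma Cexp_plus (a b : C) : Cexp (a + b) = (Cexp a * Cexp b)%C.
Proof.
  destruct a as [a1 a2], b as [b1 b2]. unfold Cexp, Cmult; simpl.
  rewrite exp_plus, cos_plus, sin_plus. f_equal; ring.
Qed.

Lemma Cexp_0 : Cexp (RtoC 0) = RtoC 1.
Proof. unfold Cexp; simpl. rewrite exp_0, cos_0, sin_0. unfold RtoC. f_equal; ring. Qed.

Lemma Cexp_neq_0 z : Cexp z <> RtoC 0.
Proof.
  intros E. assert (H : (Cexp (z + - z) = Cexp z * Cexp (- z))%C) by apply Cexp_plus.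
  rewrite E, Cplus_opp_r, Cexp_0, Cmult_0_l in H. apply RtoC_inj in H. lra.
Qed.

Lemma Cmod_Cexp z : Cmod (Cexp z) = exp (Re z).
Proof.
  unfold Cmod, Cexp; simpl. rewrite !Rmult_1_r.
  replace (_ + _) with (exp (Re z) * exp (Re z)).
  - apply sqrt_square. left; apply exp_pos.
  - assert (H := sin2_cos2 (Im z)). unfold Rsqr in H.
    replace (_ + _) with (exp (Re z) * exp (Re z) *
      (sin (Im z) * sin (Im z) + cos (Im z) * cos (Im z))) by ring.
    rewrite H; ring.
Qed.

Lemma Cexp_RtoC (x : R) : Cexp (RtoC x) = RtoC (exp x).
Proof. unfold Cexp; simpl. rewrite cos_0, sin_0. unfold RtoC. f_equal; ring. Qed.

Lemma curve_derive_Cexp_ray (z : C) t :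
  curve_derive (fun t => Cexp (RtoC t * z)) t (z * Cexp (RtoC t * z))%C.
Proof.
  destruct z as [x y]. unfold Cexp. split; simpl; auto_derive; trivial;
    change (t * x + - (0 * y)) with (t * x - 0 * y); ring.
Qed.

(** Along the ray the speed [|z exp (t z)|] is at most [|z| exp (t |z|)], the derivative of
    [exp (t |z|)]. *)
Lemma Cmod_Cexp_minus_1_le (z : C) : Cmod (Cexp z - 1) <= exp (Cmod z) - 1.
Proof.
  assert (H := curve_mean_value (fun t => Cexp (RtoC t * z))
    (fun t => z * Cexp (RtoC t * z))%C (fun t => exp (t * Cmod z))
    (fun t => Cmod z * exp (t * Cmod z))).
  cbv beta in H. rewrite Cmult_1_l, Cmult_0_l, Cexp_0, Rmult_1_l, Rmult_0_l, exp_0 in H.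
  apply H; intros t Ht.
  - apply curve_derive_Cexp_ray.
  - auto_derive; trivial. ring.
  - rewrite Cmod_mult. apply Rmult_le_compat_l; [apply Cmod_ge_0|].
    rewrite Cmod_Cexp. destruct (Rle_lt_or_eq_dec _ _ (proj1 (conj
      (Rle_trans _ _ _ (Rle_abs _) (re_le_Cmod (RtoC t * z))) I))) as [Hl|Hl];
    rewrite Cmod_mult, Cmod_R, Rabs_pos_eq in Hl by lra.
    + left. now apply exp_increasing.
    + right. now rewrite Hl.
Qed.

(** From [exp (- x) >= 1 - x] follows [exp x - 1 <= x exp x], and [exp x <= exp 1 <= 3]. *)
Lemma exp_minus_1_le x : 0 <= x <= 1 -> exp x - 1 <= 3 * x.
Proof.
  intros Hx. assert (H1 := exp_ineq1_le (- x)). rewrite exp_Ropp in H1.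
  assert (H2 := exp_pos x). assert (H3 := exp_le_3).
  assert (H4 : exp x <= exp 1).
  { destruct (Rle_lt_or_eq_dec x 1 (proj2 Hx)) as [H|H].
    - left; now apply exp_increasing.
    - right; now rewrite H. }
  apply (Rmult_le_compat_r (exp x)) in H1; [|lra]. rewrite Rinv_l in H1 by lra. nra.
Qed.

(** The curve [exp (t h) - t h] has velocity [h (exp (t h) - 1)], of modulus at most [3 t |h|^2]. *)
Lemma Cmod_Cexp_remainder_le (h : C) : Cmod h <= 1 ->
  Cmod (Cexp h - 1 - h) <= 3 * Cmod h ^ 2.
Proof.
  intros Hh. assert (H0 := Cmod_ge_0 h).
  assert (H := curve_mean_value (fun t => Cexp (RtoC t * h) - RtoC t * h)%C
    (fun t => h * Cexp (RtoC t * h) - h)%C (fun t => t * (3 * Cmod h ^ 2))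
    (fun t => 3 * Cmod h ^ 2)).
  cbv beta in H. rewrite !Cmult_1_l, !Cmult_0_l, Cexp_0, Rmult_1_l, Rmult_0_l in H.
  replace (Cexp h - 1 - h)%C with (Cexp h - h - (1 - 0))%C by ring.
  rewrite <- (Rminus_0_r (3 * Cmod h ^ 2)).
  apply H; intros t Ht.
  - destruct (curve_derive_Cexp_ray h t) as [D1 D2]. destruct (curve_derive_ray h t) as [D3 D4].
    split.
    + exact (is_derive_minus (K := R_AbsRing) (V := R_NormedModule) _ _ _ _ _ D1 D3).
    + exact (is_derive_minus (K := R_AbsRing) (V := R_NormedModule) _ _ _ _ _ D2 D4).
  - auto_derive; trivial. ring.
  - replace (h * Cexp (RtoC t * h) - h)%C with (h * (Cexp (RtoC t * h) - 1))%C by ring.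
    rewrite Cmod_mult. assert (H1 := Cmod_Cexp_minus_1_le (RtoC t * h)).
    rewrite Cmod_mult, Cmod_R, Rabs_pos_eq in H1 by lra.
    assert (H2 := exp_minus_1_le (t * Cmod h)). nra.
Qed.

Lemma is_C_derive_Cexp z : is_C_derive Cexp z (Cexp z).
Proof.
  apply is_C_derive_eps. intros eps Heps.
  assert (He := exp_pos (Re z)).
  exists (Rmin 1 (eps / (3 * exp (Re z)))). split.
  { apply Rmin_pos; [lra|]. apply Rdiv_lt_0_compat; lra. }
  intros y Hy. assert (Hy1 := Rlt_le_trans _ _ _ Hy (Rmin_l _ _)).
  assert (Hy2 := Rlt_le_trans _ _ _ Hy (Rmin_r _ _)).
  set (h := (y - z)%C) in *. replace y with (z + h)%C by (unfold h; ring).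
  rewrite Cexp_plus.
  replace (Cexp z * Cexp h - Cexp z - h * Cexp z)%C with (Cexp z * (Cexp h - 1 - h))%C by ring.
  rewrite Cmod_mult, Cmod_Cexp.
  assert (Hr := Cmod_Cexp_remainder_le h (Rlt_le _ _ Hy1)).
  apply (Rmult_lt_compat_r (3 * exp (Re z))) in Hy2; [|lra].
  unfold Rdiv in Hy2. rewrite Rmult_assoc, Rinv_l in Hy2 by lra.
  assert (H0 := Cmod_ge_0 h).
  apply Rle_trans with (exp (Re z) * (3 * Cmod h ^ 2)).
  - apply Rmult_le_compat_l; lra.
  - nra.
Qed.

(** * Goursat's theorem on a square *)

Lemma nested_intervals (x h : nat -> R) :
  (forall n, 0 <= h n) ->
  (forall n, x n <= x (S n) /\ x (S n) + h (S n) <= x n + h n) ->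
  exists p, forall n, x n <= p <= x n + h n.
Proof.
  intros Hh Hn.
  assert (Hu : forall n k, x n <= x (k + n)%nat /\ x (k + n)%nat + h (k + n)%nat <= x n + h n).
  { intros n; induction k as [|k IH]; simpl; [lra|]. specialize (Hn (k + n)%nat). lra. }
  destruct (ex_finite_lim_seq_incr x (x 0%nat + h 0%nat)) as [p Hp].
  - apply Hn.
  - intros n. destruct (Hu 0%nat n) as [_ H]. rewrite Nat.add_0_r in H. specialize (Hh n). lra.
  - exists p. intros n. split.
    + apply (is_lim_seq_incr_compare x p Hp). apply Hn.
    + apply (is_lim_seq_le_loc x (fun _ => x n + h n) p (x n + h n)); trivial.
      * exists n. intros m Hm. replace m with ((m - n) + n)%nat by lia.
        destruct (Hu n (m - n)%nat) as [_ H]. specialize (Hh (m - n + n)%nat). lra.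
      * apply is_lim_seq_const.
Qed.

(** A compactness principle: a property that always passes to some quarter of a square persists on
    arbitrarily small squares around one point. It serves both Goursat's theorem and the existence
    of maxima on a disk. *)
Lemma square_bisection (Bad : R -> R -> R -> Prop) (x y h : R) :
  0 < h -> Bad x y h ->
  (forall x y h, 0 < h -> Bad x y h ->
     Bad x y (h / 2) \/ Bad (x + h / 2) y (h / 2) \/
     Bad x (y + h / 2) (h / 2) \/ Bad (x + h / 2) (y + h / 2) (h / 2)) ->
  exists p q, forall eps, 0 < eps -> exists x' y' h', 0 < h' < eps /\
    x' <= p <= x' + h' /\ y' <= q <= y' + h' /\ Bad x' y' h'.
Proof.
  intros Hh HB Hstep.
  set (P := fun s : R * R * R => 0 < snd s /\ Bad (fst (fst s)) (snd (fst s)) (snd s)).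
  assert (Hnext : forall s : {s | P s}, exists s' : {s | P s},
    let '(x, y, h) := proj1_sig s in let '(x', y', h') := proj1_sig s' in
    h' = h / 2 /\ x <= x' /\ x' + h' <= x + h /\ y <= y' /\ y' + h' <= y + h).
  { intros [[[a b] k] [Hk H]]; simpl in *.
    destruct (Hstep a b k Hk H) as [H1|[H1|[H1|H1]]].
    - unshelve eexists (exist _ (a, b, k / 2) _); [split; simpl; trivial; lra|simpl; lra].
    - unshelve eexists (exist _ (a + k / 2, b, k / 2) _); [split; simpl; trivial; lra|simpl; lra].
    - unshelve eexists (exist _ (a, b + k / 2, k / 2) _); [split; simpl; trivial; lra|simpl; lra].
    - unshelve eexists (exist _ (a + k / 2, b + k / 2, k / 2) _);
        [split; simpl; trivial; lra|simpl; lra]. }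
  set (next := fun s => proj1_sig (constructive_indefinite_description _ (Hnext s))).
  assert (Hn : forall s, let '(x, y, h) := proj1_sig s in
    let '(x', y', h') := proj1_sig (next s) in
    h' = h / 2 /\ x <= x' /\ x' + h' <= x + h /\ y <= y' /\ y' + h' <= y + h).
  { intros s. unfold next. destruct (constructive_indefinite_description _ (Hnext s)) as [s' Hs'].
    exact Hs'. }
  set (sq := nat_rect (fun _ => {s | P s}) (exist _ (x, y, h) (conj Hh HB)) (fun _ s => next s)).
  set (X := fun n => fst (fst (proj1_sig (sq n)))).
  set (Y := fun n => snd (fst (proj1_sig (sq n)))).
  set (H := fun n => snd (proj1_sig (sq n))).
  assert (HS : forall n, H (S n) = H n / 2 /\ X n <= X (S n) /\
    X (S n) + H (S n) <= X n + H n /\ Y n <= Y (S n) /\ Y (S n) + H (S n) <= Y n + H n).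
  { intros n. unfold X, Y, H. specialize (Hn (sq n)). change (sq (S n)) with (next (sq n)).
    destruct (proj1_sig (sq n)) as [[a b] k], (proj1_sig (next (sq n))) as [[a' b'] k'].
    exact Hn. }
  assert (HP : forall n, 0 < H n /\ Bad (X n) (Y n) (H n)).
  { intros n. exact (proj2_sig (sq n)). }
  destruct (nested_intervals X H) as [p Hp].
  { intros n; left; apply HP. } { intros n; split; apply HS. }
  destruct (nested_intervals Y H) as [q Hq].
  { intros n; left; apply HP. } { intros n; split; apply HS. }
  exists p, q. intros eps Heps.
  assert (HH : forall n, H n = h * (1 / 2) ^ n).
  { induction n as [|n IH]; [unfold H; simpl; ring|].
    destruct (HS n) as [E _]. rewrite E, IH. simpl. field. }
  destruct (pow_lt_1_zero (1 / 2)) with (y := eps / h) as [n Hpow].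
  { rewrite Rabs_pos_eq; lra. } { now apply Rdiv_lt_0_compat. }
  exists (X n), (Y n), (H n).
  assert (Hlt : H n < eps).
  { rewrite HH. specialize (Hpow n (le_n n)).
    rewrite Rabs_pos_eq in Hpow by (apply pow_le; lra).
    apply (Rmult_lt_compat_l h) in Hpow; trivial.
    replace (h * (eps / h)) with eps in Hpow by (field; lra). exact Hpow. }
  repeat split; try apply HP; try apply Hp; try apply Hq; trivial.
Qed.

Lemma RInt_minus_R (f g : R -> R) a b : ex_RInt f a b -> ex_RInt g a b ->
  RInt (fun t => f t - g t) a b = RInt f a b - RInt g a b.
Proof. exact (RInt_minus (V := R_CompleteNormedModule) f g a b). Qed.

Lemma RInt_const_R (c a b : R) : RInt (fun _ => c) a b = (b - a) * c.
Proof. exact (RInt_const (V := R_CompleteNormedModule) a b c). Qed.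

Lemma ex_RInt_minus_R (f g : R -> R) a b : ex_RInt f a b -> ex_RInt g a b ->
  ex_RInt (fun t => f t - g t) a b.
Proof. exact (ex_RInt_minus (V := R_NormedModule) f g a b). Qed.

Lemma ex_RInt_const_R (c a b : R) : ex_RInt (fun _ => c) a b.
Proof. exact (ex_RInt_const (V := R_NormedModule) a b c). Qed.

Section Goursat.

Variables (P Q : R -> R -> R) (x0 y0 h0 : R).
(** The shared [c] says that [P dx + Q dy] is closed, pointwise and with no continuity of the
    partial derivatives. *)
Hypothesis Hdiff : forall x y, x0 <= x <= x0 + h0 -> y0 <= y <= y0 + h0 ->
  exists a b c, differentiable_pt_lim P x y a c /\ differentiable_pt_lim Q x y c b.

(** Counterclockwise integral of [P dx + Q dy] around the square with lower left corner [(x, y)] and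
    side [h]. *)
Let circ (x y h : R) : R :=
  RInt (fun s => P s y) x (x + h) + RInt (fun t => Q (x + h) t) y (y + h)
  - RInt (fun s => P s (y + h)) x (x + h) - RInt (fun t => Q x t) y (y + h).

Lemma continuity_2d_continuous_l (f : R -> R -> R) x y :
  continuity_2d_pt f x y -> continuous (fun s => f s y) x.
Proof.
  intros H. apply continuity_pt_filterlim. apply continuity_pt_locally. intros eps.
  destruct (H eps) as [d Hd]. exists d. intros u Hu. apply Hd; trivial.
  rewrite Rminus_diag, Rabs_R0. apply cond_pos.
Qed.

Lemma continuity_2d_continuous_r (f : R -> R -> R) x y :
  continuity_2d_pt f x y -> continuous (fun t => f x t) y.
Proof.
  intros H. apply continuity_pt_filterlim. apply continuity_pt_locally. intros eps.
  destruct (H eps) as [d Hd]. exists d. intros u Hu. apply Hd; trivial.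
  rewrite Rminus_diag, Rabs_R0. apply cond_pos.
Qed.

Lemma goursat_ex_RInt_P y a b : x0 <= a -> a <= b -> b <= x0 + h0 -> y0 <= y <= y0 + h0 ->
  ex_RInt (fun s => P s y) a b.
Proof.
  intros. apply (ex_RInt_continuous (V := R_CompleteNormedModule)). intros s Hs.
  rewrite Rmin_left, Rmax_right in Hs by lra.
  apply continuity_2d_continuous_l. apply differentiable_continuity_pt.
  destruct (Hdiff s y) as (a' & b' & c & H3 & _); try lra. exists a', c; exact H3.
Qed.

Lemma goursat_ex_RInt_Q x a b : y0 <= a -> a <= b -> b <= y0 + h0 -> x0 <= x <= x0 + h0 ->
  ex_RInt (fun t => Q x t) a b.
Proof.
  intros. apply (ex_RInt_continuous (V := R_CompleteNormedModule)). intros s Hs.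
  rewrite Rmin_left, Rmax_right in Hs by lra.
  apply continuity_2d_continuous_r. apply differentiable_continuity_pt.
  destruct (Hdiff x s) as (a' & b' & c & _ & H3); try lra. exists c, b'; exact H3.
Qed.

Let inside (x y h : R) : Prop := x0 <= x /\ x + h <= x0 + h0 /\ y0 <= y /\ y + h <= y0 + h0.

Lemma circ_split x y h : 0 < h -> inside x y h ->
  circ x y h = circ x y (h / 2) + circ (x + h / 2) y (h / 2) +
    circ x (y + h / 2) (h / 2) + circ (x + h / 2) (y + h / 2) (h / 2).
Proof.
  intros Hh (H1 & H2 & H3 & H4). unfold circ.
  replace (x + h / 2 + h / 2) with (x + h) by field.
  replace (y + h / 2 + h / 2) with (y + h) by field.
  assert (EP : forall z, y0 <= z <= y0 + h0 -> RInt (fun s => P s z) x (x + h) =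
    RInt (fun s => P s z) x (x + h / 2) + RInt (fun s => P s z) (x + h / 2) (x + h)).
  { intros z Hz. symmetry.
    apply (RInt_Chasles (V := R_CompleteNormedModule)); apply goursat_ex_RInt_P; lra. }
  assert (EQ : forall z, x0 <= z <= x0 + h0 -> RInt (fun t => Q z t) y (y + h) =
    RInt (fun t => Q z t) y (y + h / 2) + RInt (fun t => Q z t) (y + h / 2) (y + h)).
  { intros z Hz. symmetry.
    apply (RInt_Chasles (V := R_CompleteNormedModule)); apply goursat_ex_RInt_Q; lra. }
  rewrite !EP, !EQ by lra. ring.
Qed.

(** The linear parts contribute [c h^2] from the vertical sides and [- c h^2] from the horizontal
    ones, which cancel by closedness. Each pair of opposite sides leaves an error of at most
    [2 eps h] over a length [h]. *)
Lemma circ_small p q a b c eps : 0 < eps ->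
  differentiable_pt_lim P p q a c -> differentiable_pt_lim Q p q c b ->
  exists d, 0 < d /\ forall x y h, 0 < h < d -> inside x y h ->
    x <= p <= x + h -> y <= q <= y + h -> Rabs (circ x y h) <= 4 * eps * h ^ 2.
Proof.
  intros Heps HP HQ.
  destruct (HP (mkposreal eps Heps)) as [d1 Hd1], (HQ (mkposreal eps Heps)) as [d2 Hd2].
  simpl in Hd1, Hd2.
  exists (Rmin d1 d2). split; [apply Rmin_pos; apply cond_pos|].
  intros x y h Hh (H1 & H2 & H3 & H4) Hp Hq.
  assert (Hh1 := Rlt_le_trans _ _ _ (proj2 Hh) (Rmin_l _ _)).
  assert (Hh2 := Rlt_le_trans _ _ _ (proj2 Hh) (Rmin_r _ _)).
  assert (Hnear : forall u v, x <= u <= x + h -> y <= v <= y + h ->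
    Rabs (u - p) <= h /\ Rabs (v - q) <= h).
  { intros; split; apply Rabs_le; lra. }
  assert (EP : forall u v, x <= u <= x + h -> y <= v <= y + h ->
    Rabs (P u v - P p q - (a * (u - p) + c * (v - q))) <= eps * h).
  { intros u v Hu Hv. destruct (Hnear u v Hu Hv).
    eapply Rle_trans; [apply Hd1; lra|]. apply Rmult_le_compat_l; [lra|]. now apply Rmax_lub. }
  assert (EQ : forall u v, x <= u <= x + h -> y <= v <= y + h ->
    Rabs (Q u v - Q p q - (c * (u - p) + b * (v - q))) <= eps * h).
  { intros u v Hu Hv. destruct (Hnear u v Hu Hv).
    eapply Rle_trans; [apply Hd2; lra|]. apply Rmult_le_compat_l; [lra|]. now apply Rmax_lub. }
  assert (XP : forall v, y <= v <= y + h -> ex_RInt (fun s => P s v) x (x + h)).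
  { intros; apply goursat_ex_RInt_P; lra. }
  assert (XQ : forall u, x <= u <= x + h -> ex_RInt (fun t => Q u t) y (y + h)).
  { intros; apply goursat_ex_RInt_Q; lra. }
  assert (IP : Rabs (RInt (fun s => P s (y + h) - P s y - c * h) x (x + h)) <=
    (x + h - x) * (2 * eps * h)).
  { apply abs_RInt_le_const; [lra| |].
    - apply ex_RInt_minus_R; [apply ex_RInt_minus_R; apply XP; lra|apply ex_RInt_const_R].
    - intros s Hs. assert (E1 := EP s (y + h)). assert (E2 := EP s y).
      apply Rabs_le_between in E1; [|lra|lra]. apply Rabs_le_between in E2; [|lra|lra].
      apply Rabs_le. nra. }
  assert (IQ : Rabs (RInt (fun t => Q (x + h) t - Q x t - c * h) y (y + h)) <=
    (y + h - y) * (2 * eps * h)).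
  { apply abs_RInt_le_const; [lra| |].
    - apply ex_RInt_minus_R; [apply ex_RInt_minus_R; apply XQ; lra|apply ex_RInt_const_R].
    - intros s Hs. assert (E1 := EQ (x + h) s). assert (E2 := EQ x s).
      apply Rabs_le_between in E1; [|lra|lra]. apply Rabs_le_between in E2; [|lra|lra].
      apply Rabs_le. nra. }
  assert (FP : RInt (fun s => P s (y + h) - P s y - c * h) x (x + h) =
    RInt (fun s => P s (y + h)) x (x + h) - RInt (fun s => P s y) x (x + h) -
    (x + h - x) * (c * h)).
  { rewrite <- RInt_const_R, <- RInt_minus_R by (apply XP; lra).
    apply (RInt_minus_R (fun s => P s (y + h) - P s y)); [|apply ex_RInt_const_R].
    apply ex_RInt_minus_R; apply XP; lra. }
  assert (FQ : RInt (fun t => Q (x + h) t - Q x t - c * h) y (y + h) =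
    RInt (fun t => Q (x + h) t) y (y + h) - RInt (fun t => Q x t) y (y + h) -
    (y + h - y) * (c * h)).
  { rewrite <- RInt_const_R, <- RInt_minus_R by (apply XQ; lra).
    apply (RInt_minus_R (fun t => Q (x + h) t - Q x t)); [|apply ex_RInt_const_R].
    apply ex_RInt_minus_R; apply XQ; lra. }
  rewrite FP in IP. rewrite FQ in IQ. unfold circ.
  apply Rabs_le_between in IP, IQ. apply Rabs_le. lra.
Qed.

Lemma goursat_square : 0 < h0 ->
  RInt (fun s => P s y0) x0 (x0 + h0) + RInt (fun t => Q (x0 + h0) t) y0 (y0 + h0) =
  RInt (fun s => P s (y0 + h0)) x0 (x0 + h0) + RInt (fun t => Q x0 t) y0 (y0 + h0).
Proof.
  intros Hh0. enough (circ x0 y0 h0 = 0) by (unfold circ in *; lra).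
  destruct (Req_dec (circ x0 y0 h0) 0) as [E|E]; trivial. exfalso.
  apply Rabs_pos_lt in E. set (k := Rabs (circ x0 y0 h0) / h0 ^ 2).
  assert (Hk : 0 < k) by (apply Rdiv_lt_0_compat; [exact E|now apply pow_lt]).
  (* Some quarter carries at least a quarter of the circulation, and its area is a quarter too, so
     the ratio [k] is inherited. *)
  destruct (square_bisection (fun x y h => inside x y h /\ k * h ^ 2 <= Rabs (circ x y h))
    x0 y0 h0) as (p & q & Hpq); trivial.
  - split; [unfold inside; lra|]. right. unfold k. field. lra.
  - intros x y h Hh [Hin Hc]. rewrite circ_split in Hc by trivial.
    assert (Hsplit : forall a b c d m, m <= Rabs (a + b + c + d) ->
      m / 4 <= Rabs a \/ m / 4 <= Rabs b \/ m / 4 <= Rabs c \/ m / 4 <= Rabs d).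
    { intros a b c d m Hm. assert (H1 := Rabs_triang (a + b + c) d).
      assert (H2 := Rabs_triang (a + b) c). assert (H3 := Rabs_triang a b).
      destruct (Rle_dec (m / 4) (Rabs a)); [tauto|].
      destruct (Rle_dec (m / 4) (Rabs b)); [tauto|].
      destruct (Rle_dec (m / 4) (Rabs c)); [tauto|].
      right; right; right. lra. }
    apply Hsplit in Hc. replace (k * h ^ 2 / 4) with (k * (h / 2) ^ 2) in Hc by field.
    unfold inside in *.
    destruct Hc as [Hc|[Hc|[Hc|Hc]]]; [left|right; left|right; right; left|right; right; right];
      (split; [lra|exact Hc]).
  - assert (Hin : x0 <= p <= x0 + h0 /\ y0 <= q <= y0 + h0).
    { destruct (Hpq 1 Rlt_0_1) as (x & y & h & Hh & Hp & Hq & (H1 & H2 & H3 & H4) & _). lra. }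
    destruct (Hdiff p q) as (a & b & c & HP & HQ); try tauto.
    (* With [k / 8] the circulation is at most [k h^2 / 2], against the lower bound [k h^2]. *)
    destruct (circ_small p q a b c (k / 8)) as [d [Hd Hs]]; trivial; [lra|].
    destruct (Hpq d Hd) as (x & y & h & Hh & Hp & Hq & Hi & Hc).
    specialize (Hs x y h Hh Hi Hp Hq). assert (0 < h ^ 2) by (apply pow_lt; lra). nra.
Qed.

End Goursat.

(** * Maxima on a disk and means on circles *)

Lemma Cmod_le_square (a b : C) x y h :
  x <= Re a <= x + h -> y <= Im a <= y + h -> x <= Re b <= x + h -> y <= Im b <= y + h ->
  Cmod (a - b) <= 2 * h.
Proof.
  intros. destruct a, b; simpl in *. apply Cmod_le_2; apply Rabs_le; simpl; lra.
Qed.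

(* Bisection keeps a square containing, for every [z] of the disk, a point of the disk at which
   [V] is at least [V z]. *)
Lemma disk_attains_max (V : C -> R) (r : R) : 0 < r ->
  (forall z, Cmod z <= r -> forall eps, 0 < eps -> exists d, 0 < d /\
     forall y, Cmod y <= r -> Cmod (y - z) < d -> Rabs (V y - V z) < eps) ->
  exists a, Cmod a <= r /\ forall z, Cmod z <= r -> V z <= V a.
Proof.
  intros Hr HV.
  destruct (square_bisection (fun x y h => forall z, Cmod z <= r -> exists z', Cmod z' <= r /\
      x <= Re z' <= x + h /\ y <= Im z' <= y + h /\ V z <= V z') (- r) (- r) (2 * r))
    as (p & q & Hpq).
  - lra.
  - intros z Hz. exists z. assert (H1 := Rle_trans _ _ _ (re_le_Cmod z) Hz).
    assert (H2 := Rle_trans _ _ _ (Rle_trans _ _ _ (Rmax_r _ _) (Rmax_Cmod z)) Hz).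
    apply Rabs_le_between in H1, H2. unfold Re, Im in *. repeat split; lra.
  (* If every quarter fails, each has a point that nothing in it dominates. The best of the four is
     dominated by some [z'] of the whole square, and the quarter holding [z'] is contradicted. *)
  - intros x y h Hh HB. apply NNPP. intros HN.
    apply not_or_and in HN as [N1 HN]. apply not_or_and in HN as [N2 HN].
    apply not_or_and in HN as [N3 N4].
    apply not_all_ex_not in N1 as [z1 N1], N2 as [z2 N2], N3 as [z3 N3], N4 as [z4 N4].
    apply imply_to_and in N1 as [K1 N1], N2 as [K2 N2], N3 as [K3 N3], N4 as [K4 N4].
    assert (Hz : exists z, Cmod z <= r /\ V z1 <= V z /\ V z2 <= V z /\ V z3 <= V z /\ V z4 <= V z).
    { assert (H2 : forall a b, Cmod a <= r -> Cmod b <= r ->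
        exists z, Cmod z <= r /\ V a <= V z /\ V b <= V z).
      { intros a b Ha Hb. destruct (Rle_dec (V a) (V b)); [exists b|exists a]; repeat split; lra. }
      destruct (H2 z1 z2 K1 K2) as (u & Ku & ? & ?), (H2 z3 z4 K3 K4) as (v & Kv & ? & ?).
      destruct (H2 u v Ku Kv) as (z & Kz & ? & ?). exists z. repeat split; lra. }
    destruct Hz as (z & Kz & G1 & G2 & G3 & G4).
    destruct (HB z Kz) as (z' & Kz' & Hx & Hy & Hzz').
    destruct (Rle_dec (Re z') (x + h / 2)), (Rle_dec (Im z') (y + h / 2)).
    + apply N1. exists z'; repeat split; lra.
    + apply N3. exists z'; repeat split; lra.
    + apply N2. exists z'; repeat split; lra.
    + apply N4. exists z'; repeat split; lra.
  - assert (Hnear : forall z, Cmod z <= r -> forall d, 0 < d ->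
      exists z', Cmod z' <= r /\ Cmod (z' - (p, q)) < d /\ V z <= V z').
    { intros z Hz d Hd. destruct (Hpq (d / 3)) as (x & y & h & Hh & Hp & Hq & HB); [lra|].
      destruct (HB z Hz) as (z' & Kz' & Hx & Hy & Hzz'). exists z'. repeat split; trivial.
      apply Rle_lt_trans with (2 * h); [|lra]. apply Cmod_le_square with x y; trivial. }
    assert (Kp : Cmod (p, q) <= r).
    { apply Rnot_lt_le. intros Hlt.
      destruct (Hnear 0%C) with (d := Cmod (p, q) - r) as (z' & Kz' & Hd & _).
      - rewrite Cmod_0; lra.
      - lra.
      - assert (Ht := Cmod_triangle z' (- (z' - (p, q)))). rewrite Cmod_opp in Ht.
        assert (E : forall u v : C, (u + - (u - v) = v)%C) by (intros; ring).
        rewrite E in Ht. lra. }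
    exists (p, q). split; trivial. intros z Hz. apply Rnot_lt_le. intros Hlt.
    destruct (HV (p, q) Kp (V z - V (p, q))) as (d & Hd & Hc); [lra|].
    destruct (Hnear z Hz d Hd) as (z' & Kz' & Hd' & Hzz').
    specialize (Hc z' Kz' Hd'). apply Rabs_lt_between in Hc. lra.
Qed.

(** Logarithmic coordinates at [a]: [s] is the logarithm of the radius and [t] the angle. *)
Definition circle_point (a : C) (s t : R) : C := (a + Cexp (s, t))%C.

Lemma Cmod_circle_point a s t : Cmod (circle_point a s t - a) = exp s.
Proof.
  unfold circle_point. replace (a + Cexp (s, t) - a)%C with (Cexp (s, t)) by ring.
  apply Cmod_Cexp.
Qed.

Section CircleMean.

Variables (F : C -> C) (a : C) (r : R).
(** The centre is treated apart so that a difference quotient extended by its limit qualifies. *)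
Hypothesis Fcont : C_continuous F a.
Hypothesis Fdiff : forall z, 0 < Cmod (z - a) < r -> exists l, is_C_derive F z l.

Let mean (s : R) : R := RInt (fun t => Re (F (circle_point a s t))) 0 (2 * PI).

Lemma circle_diff s t : exp s < r ->
  exists l, is_C_derive (fun z => F (a + Cexp z)%C) (s, t) l.
Proof.
  intros Hs. destruct (Fdiff (circle_point a s t)) as [l Hl].
  { rewrite Cmod_circle_point. split; [apply exp_pos|exact Hs]. }
  eexists. apply (is_C_derive_comp F (fun z => (a + Cexp z)%C)); [exact Hl|].
  apply is_C_derive_plus; [apply is_C_derive_const|apply is_C_derive_Cexp].
Qed.

Lemma ex_RInt_circle s : exp s < r ->
  ex_RInt (fun t => Re (F (circle_point a s t))) 0 (2 * PI).
Proof.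
  intros Hs. apply (ex_RInt_continuous (V := R_CompleteNormedModule)). intros t _.
  destruct (circle_diff s t Hs) as [l Hl]. apply is_C_derive_differentiable in Hl as [Hl _].
  apply (continuity_2d_continuous_r (fun u v => Re (F (circle_point a u v)))).
  apply differentiable_continuity_pt. eexists; eexists; exact Hl.
Qed.

(** Goursat is applied to the imaginary part of [F (a + exp zeta) d zeta] on a square of side
    [2 PI]. The horizontal sides cancel because [exp] has period [2 i PI]; the vertical sides are
    the two means. *)
Lemma mean_shift s : exp s < r -> mean (s - 2 * PI) = mean s.
Proof.
  intros Hs. assert (HPI := PI_RGT_0).
  assert (H := goursat_square (fun u v => Im (F (circle_point a u v)))
    (fun u v => Re (F (circle_point a u v))) (s - 2 * PI) 0 (2 * PI)).
  replace (s - 2 * PI + 2 * PI) with s in H by ring.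
  rewrite Rplus_0_l in H.
  rewrite (RInt_ext (fun u => Im (F (circle_point a u (2 * PI))))
    (fun u => Im (F (circle_point a u 0)))) in H.
  - symmetry. eapply Rplus_eq_reg_l. apply H; [|lra]. clear H. intros x y Hx Hy.
    destruct (circle_diff x y) as [l Hl].
    { destruct (proj2 Hx) as [Hlt|E]; [|now rewrite E].
      apply exp_increasing in Hlt. lra. }
    destruct (is_C_derive_differentiable _ _ _ _ Hl) as [H1 H2].
    exists (Im l), (- Im l), (Re l). split; assumption.
  - intros u _. unfold circle_point, Cexp; simpl. now rewrite cos_2PI, sin_2PI, cos_0, sin_0.
Qed.

Lemma mean_shift_n s n : exp s < r -> mean (s - 2 * PI * INR n) = mean s.
Proof.
  intros Hs. assert (HPI := PI_RGT_0). induction n as [|n IH].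
  - simpl. f_equal; ring.
  - rewrite <- IH, S_INR. rewrite <- (mean_shift (s - 2 * PI * INR n)).
    + f_equal; ring.
    + eapply Rle_lt_trans; [|exact Hs]. assert (0 <= INR n) by apply pos_INR.
      destruct (Rle_lt_or_eq_dec (s - 2 * PI * INR n) s) as [Hl|E]; [nra| |].
      * left; now apply exp_increasing.
      * right; now rewrite E.
Qed.

Lemma circle_mean_value s : exp s < r ->
  RInt (fun t => Re (F (circle_point a s t))) 0 (2 * PI) = 2 * PI * Re (F a).
Proof.
  intros Hs. change (mean s = 2 * PI * Re (F a)). assert (HPI := PI_RGT_0).
  apply cond_eq. intros eps Heps.
  destruct (Fcont (eps / (4 * PI))) as [d [Hd Hc]].
  { apply Rdiv_lt_0_compat; lra. }
  (* After enough shifts the circle has radius below [d], where [F] is close to [F a]. *)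
  destruct (INR_unbounded ((s - ln d) / (2 * PI))) as [n Hn].
  assert (Hsn : exp (s - 2 * PI * INR n) < d).
  { apply Rlt_le_trans with (exp (ln d)); [|right; now apply exp_ln].
    apply exp_increasing.
    apply Rgt_lt in Hn. apply Rlt_div_l in Hn; lra. }
  assert (Hsr : exp (s - 2 * PI * INR n) < r).
  { eapply Rle_lt_trans; [|exact Hs]. assert (0 <= INR n) by apply pos_INR.
    destruct (Rle_lt_or_eq_dec (s - 2 * PI * INR n) s) as [Hl|E]; [nra| |].
    - left; now apply exp_increasing.
    - right; now rewrite E. }
  rewrite <- (mean_shift_n s n Hs).
  assert (HI : Rabs (RInt (fun t => Re (F (circle_point a (s - 2 * PI * INR n) t)) - Re (F a))
    0 (2 * PI)) <= (2 * PI - 0) * (eps / (4 * PI))).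
  { apply abs_RInt_le_const; [lra| |].
    - apply ex_RInt_minus_R; [now apply ex_RInt_circle|apply ex_RInt_const_R].
    - intros t _. left. eapply Rle_lt_trans; [|apply (Hc (circle_point a (s - 2 * PI * INR n) t))].
      + eapply Rle_trans; [|apply re_le_Cmod]. right; f_equal.
      + now rewrite Cmod_circle_point. }
  rewrite RInt_minus_R, RInt_const_R in HI;
    [|now apply ex_RInt_circle|apply ex_RInt_const_R].
  replace ((2 * PI - 0) * (eps / (4 * PI))) with (eps / 2) in HI by (field; lra).
  rewrite Rminus_0_r in HI. unfold mean.
  eapply Rle_lt_trans; [exact HI|lra].
Qed.

End CircleMean.

(** * The Schwarz lemma *)

(* Otherwise [Re (conj (F a) * F) + eps |z|^2] would be at most its value at [a] on a small circle
   centred at [a], while its mean there exceeds that value, [|z|^2] being strictly subharmonic. *)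
Lemma no_interior_max (F : C -> C) (a : C) (r eps : R) : 0 < r -> 0 < eps ->
  C_continuous F a -> (forall z, 0 < Cmod (z - a) < r -> exists l, is_C_derive F z l) ->
  (forall y, Cmod (y - a) < r ->
     Cmod (F y) ^ 2 + 2 * eps * Cmod y ^ 2 <= Cmod (F a) ^ 2 + 2 * eps * Cmod a ^ 2) ->
  False.
Proof.
  intros Hr Heps Fc Fd Hmax. assert (HPI := PI_RGT_0).
  set (s := ln (r / 2)).
  assert (Es : exp s = r / 2) by (apply exp_ln; lra).
  set (G := fun z => (Cconj (F a) * F z)%C).
  assert (Gc : C_continuous G a).
  { intros e He. assert (H0 := Cmod_ge_0 (F a)).
    destruct (Fc (e / (Cmod (F a) + 1))) as [d [Hd Hc]]; [apply Rdiv_lt_0_compat; lra|].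
    exists d; split; trivial. intros y Hy. specialize (Hc y Hy). unfold G.
    replace (Cconj (F a) * F y - Cconj (F a) * F a)%C with (Cconj (F a) * (F y - F a))%C by ring.
    rewrite Cmod_mult, Cmod_conj. apply (Rmult_lt_compat_l (Cmod (F a) + 1)) in Hc; [|lra].
    replace ((Cmod (F a) + 1) * (e / (Cmod (F a) + 1))) with e in Hc by (field; lra).
    assert (H1 := Cmod_ge_0 (F y - F a)). lra. }
  assert (Gd : forall z, 0 < Cmod (z - a) < r -> exists l, is_C_derive G z l).
  { intros z Hz. destruct (Fd z Hz) as [l Hl]. eexists.
    apply is_C_derive_mult; [apply is_C_derive_const|exact Hl]. }
  assert (Hs : exp s < r) by lra.
  assert (Hmean := circle_mean_value G a r Gc Gd s Hs).
  assert (EGa : Re (G a) = Cmod (F a) ^ 2).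
  { unfold G. rewrite Cmod2_alt. destruct (F a); simpl; ring. }
  (* [m t] bounds [Re (G y)] at the point [y] of angle [t] on the circle of radius [r / 2]: it is
     [|F a|^2 + eps (|a|^2 - |y|^2)], obtained from [Re (G y) <= (|F a|^2 + |F y|^2) / 2], whence
     the [2 * eps] in [Hmax]. The trigonometric part has mean zero, so the mean of [m] is
     [k < |F a|^2]. *)
  set (k := Cmod (F a) ^ 2 - eps * (r / 2) ^ 2).
  set (m := fun t => k - eps * r * (Re a * cos t + Im a * sin t)).
  assert (Hm : is_RInt m 0 (2 * PI)
    (minus (k * (2 * PI) - eps * r * (Re a * sin (2 * PI) - Im a * cos (2 * PI)))
       (k * 0 - eps * r * (Re a * sin 0 - Im a * cos 0)))).
  { apply (is_RInt_derive (V := R_CompleteNormedModule)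
      (fun t => k * t - eps * r * (Re a * sin t - Im a * cos t)) m).
    - intros t _. unfold m. auto_derive; trivial. ring.
    - intros t _. apply (ex_derive_continuous (V := R_NormedModule)). unfold m. auto_derive; trivial. }
  rewrite cos_2PI, sin_2PI, cos_0, sin_0 in Hm.
  assert (Hle : RInt (fun t => Re (G (circle_point a s t))) 0 (2 * PI) <= RInt m 0 (2 * PI)).
  { apply RInt_le; [lra|now apply (ex_RInt_circle G a r)|eexists; exact Hm|].
    intros t _. specialize (Hmax (circle_point a s t)).
    rewrite Cmod_circle_point in Hmax. specialize (Hmax Hs).
    assert (E : Cmod (circle_point a s t) ^ 2 =
      Cmod a ^ 2 + (r / 2) ^ 2 + r * (Re a * cos t + Im a * sin t)).
    { rewrite !Cmod2_alt. unfold circle_point, Cexp. destruct a as [a1 a2]; simpl.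
      rewrite Es. assert (Ht := sin2_cos2 t). unfold Rsqr in Ht.
      transitivity (a1 * a1 + a2 * a2 + (r / 2) * (r / 2) * (sin t * sin t + cos t * cos t)
        + r * (a1 * cos t + a2 * sin t)); [field|rewrite Ht; ring]. }
    rewrite E in Hmax.
    assert (Hc := Re_Cconj_mult_le (F a) (F (circle_point a s t))).
    assert (ER : Re (G (circle_point a s t)) = Re (F a) * Re (F (circle_point a s t)) +
      Im (F a) * Im (F (circle_point a s t))).
    { unfold G. destruct (F a), (F (circle_point a s t)); simpl; ring. }
    rewrite ER. unfold m, k.
    assert (Hsq := pow2_ge_0 (Cmod (F a) - Cmod (F (circle_point a s t)))). nra. }
  rewrite Hmean, EGa, (is_RInt_unique _ _ _ _ Hm) in Hle.
  unfold minus, plus, opp in Hle; simpl in Hle. unfold k in Hle.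
  assert (0 < eps * (r / 2) ^ 2 * (2 * PI)).
  { apply Rmult_lt_0_compat; [|lra]. apply Rmult_lt_0_compat; [lra|]. apply pow_lt; lra. }
  lra.
Qed.

Lemma C_continuous_perturbed_sq_norm (F : C -> C) z k : C_continuous F z -> forall eps, 0 < eps ->
  exists d, 0 < d /\ forall y, Cmod (y - z) < d ->
    Rabs (Cmod (F y) ^ 2 + k * Cmod y ^ 2 - (Cmod (F z) ^ 2 + k * Cmod z ^ 2)) < eps.
Proof.
  intros Fc eps Heps.
  assert (Hsq : forall u v e, 0 < e -> 0 <= u -> 0 <= v ->
    Rabs (u - v) < Rmin 1 (e / (2 * v + 2)) -> Rabs (u ^ 2 - v ^ 2) < e).
  { intros u v e He Hu Hv H. assert (H1 := Rlt_le_trans _ _ _ H (Rmin_l _ _)).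
    assert (H2 := Rlt_le_trans _ _ _ H (Rmin_r _ _)).
    replace (u ^ 2 - v ^ 2) with ((u - v) * (u + v)) by ring.
    rewrite Rabs_mult, (Rabs_pos_eq (u + v)) by lra.
    apply (Rmult_lt_compat_r (2 * v + 2)) in H2; [|lra].
    replace (e / (2 * v + 2) * (2 * v + 2)) with e in H2 by (field; lra).
    apply Rabs_lt_between in H1. assert (H3 := Rabs_pos (u - v)). nra. }
  assert (Hpos : forall e v, 0 < e -> 0 <= v -> 0 < Rmin 1 (e / (2 * v + 2))).
  { intros e v He Hv. apply Rmin_pos; [lra|]. apply Rdiv_lt_0_compat; lra. }
  assert (Hk : 0 <= Rabs k) by apply Rabs_pos.
  set (e2 := eps / (2 * (Rabs k + 1))).
  assert (He2 : 0 < e2) by (apply Rdiv_lt_0_compat; lra).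
  destruct (Fc _ (Hpos (eps / 2) (Cmod (F z)) ltac:(lra) (Cmod_ge_0 _))) as [d [Hd Hc]].
  exists (Rmin d (Rmin 1 (e2 / (2 * Cmod z + 2)))). split.
  { apply Rmin_pos; trivial. apply Hpos; trivial. apply Cmod_ge_0. }
  intros y Hy. assert (Hy1 := Rlt_le_trans _ _ _ Hy (Rmin_l _ _)).
  assert (Hy2 := Rlt_le_trans _ _ _ Hy (Rmin_r _ _)).
  assert (A := Hsq (Cmod (F y)) (Cmod (F z)) (eps / 2) ltac:(lra) (Cmod_ge_0 _) (Cmod_ge_0 _)
    (Rle_lt_trans _ _ _ (Cmod_minus_Cmod_le _ _) (Hc y Hy1))).
  assert (B := Hsq (Cmod y) (Cmod z) e2 He2 (Cmod_ge_0 _) (Cmod_ge_0 _)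
    (Rle_lt_trans _ _ _ (Cmod_minus_Cmod_le _ _) Hy2)).
  replace (Cmod (F y) ^ 2 + k * Cmod y ^ 2 - (Cmod (F z) ^ 2 + k * Cmod z ^ 2)) with
    ((Cmod (F y) ^ 2 - Cmod (F z) ^ 2) + k * (Cmod y ^ 2 - Cmod z ^ 2)) by ring.
  eapply Rle_lt_trans; [apply Rabs_triang|]. rewrite Rabs_mult.
  assert (Rabs k * Rabs (Cmod y ^ 2 - Cmod z ^ 2) <= Rabs k * e2)
    by (apply Rmult_le_compat_l; lra).
  assert (Rabs k * e2 <= eps / 2).
  { assert (E : (Rabs k + 1) * e2 = eps / 2) by (unfold e2; field; lra). lra. }
  lra.
Qed.

(** The quotient [F = w z / z], completed by [w' 0], has modulus at most [1 / r] on the circle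
    [|z| = r]. The perturbed square [|F|^2 + 2 eps |z|^2] attains its maximum over the closed disk
    only there; then [eps] becomes small and [r] approaches 1. *)
Lemma schwarz_lemma (w : C -> C) :
  analytic_on_D w -> w (RtoC 0) = RtoC 0 -> (forall z, in_D z -> Cmod (w z) < 1) ->
  forall z, in_D z -> Cmod (w z) <= Cmod z.
Proof.
  intros Hw H0 H1 z Hz. unfold in_D in *.
  destruct (Hw (RtoC 0)) as [l0 Hl0]; [unfold in_D; rewrite Cmod_0; lra|].
  set (F := fun z => if excluded_middle_informative (z = RtoC 0) then l0 else (w z / z)%C).
  assert (F0 : F (RtoC 0) = l0).
  { unfold F. now destruct (excluded_middle_informative _). }
  assert (Fn : forall z, z <> RtoC 0 -> F z = (w z / z)%C).
  { intros y Hy. unfold F. now destruct (excluded_middle_informative _). }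
  assert (FM : forall y, Cmod (w y) = Cmod y * Cmod (F y)).
  { intros y. destruct (excluded_middle_informative (y = RtoC 0)) as [->|Hy].
    - rewrite H0, Cmod_0. ring.
    - rewrite Fn, <- Cmod_mult by trivial. f_equal. field. exact Hy. }
  assert (Fd : forall y, 0 < Cmod y < 1 -> exists l, is_C_derive F y l).
  { intros y Hy. assert (Hyn : y <> RtoC 0) by (apply Cmod_gt_0; lra).
    destruct (Hw y) as [l Hl]; [apply Hy|]. eexists.
    apply (is_C_derive_ext_near (fun x => w x * / x)%C F y _ (Cmod y)); [lra| |].
    - intros x Hx. rewrite Fn; trivial. intros E. rewrite E in Hx.
      replace (0 - y)%C with (- y)%C in Hx by ring. rewrite Cmod_opp in Hx. lra.
    - apply is_C_derive_mult; [exact Hl|]. apply is_C_derive_inv; [apply is_C_derive_id|exact Hyn]. }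
  assert (Fc : forall y, Cmod y < 1 -> C_continuous F y).
  { intros y Hy. destruct (excluded_middle_informative (y = RtoC 0)) as [->|Hn].
    - intros eps Heps. change (is_C_derive w (RtoC 0) l0) in Hl0. rewrite is_C_derive_eps in Hl0.
      destruct (Hl0 (eps / 2)) as [d [Hd Hc]]; [lra|]. exists d; split; trivial.
      intros y Hy'. destruct (excluded_middle_informative (y = RtoC 0)) as [->|Hn].
      + replace (F 0 - F 0)%C with (RtoC 0) by ring. rewrite Cmod_0; lra.
      + specialize (Hc y Hy'). rewrite H0 in Hc. rewrite Fn, F0 by trivial.
        replace (w y - 0 - (y - 0) * l0)%C with (y * (w y / y - l0))%C in Hc by (field; exact Hn).
        replace (y - 0)%C with y in Hc by ring. rewrite Cmod_mult in Hc.
        apply Cmod_gt_0 in Hn. assert (Hx := Cmod_ge_0 (w y / y - l0)). nra.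
    - destruct (Fd y) as [l Hl]; [split; [now apply Cmod_gt_0|exact Hy]|].
      eapply is_C_derive_continuous; exact Hl. }
  assert (Hbound : forall r eps, 0 < eps -> Cmod z <= r -> 0 < r < 1 ->
    Cmod (F z) ^ 2 <= (/ r) ^ 2 + 2 * eps).
  { intros r eps Heps Hzr Hr.
    destruct (disk_attains_max (fun z => Cmod (F z) ^ 2 + (2 * eps) * Cmod z ^ 2) r)
      as (a & Ha & Hmax); [lra| |].
    { intros y Hy e He. destruct (C_continuous_perturbed_sq_norm F y (2 * eps)) with (eps := e)
        as [d [Hd Hc]]; trivial. { apply Fc; lra. }
      exists d; split; trivial. intros x _ Hx. now apply Hc. }
    destruct (Rle_lt_or_eq_dec _ _ Ha) as [Hlt|E].
    (* The disk of radius [rho] around [a] stays in [|z| < r] and, punctured at [a], avoids the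
       origin, where [F] is only known to be continuous. *)
    - exfalso. set (rho := if Rlt_dec 0 (Cmod a) then Rmin (Cmod a) (r - Cmod a) else r - Cmod a).
      assert (Hrho : 0 < rho /\ rho <= r - Cmod a /\ (0 < Cmod a -> rho <= Cmod a)).
      { unfold rho. destruct (Rlt_dec 0 (Cmod a)).
        - repeat split; [apply Rmin_pos; lra|apply Rmin_r|intros; apply Rmin_l].
        - repeat split; lra. }
      apply (no_interior_max F a rho eps); try tauto.
      + apply Fc; lra.
      + intros y Hy. assert (T := Cmod_le_minus_plus y a).
        apply Fd. split; [|lra]. apply Cmod_gt_0. intros E. rewrite E in Hy.
        replace (0 - a)%C with (- a)%C in Hy by ring. rewrite Cmod_opp in Hy.
        destruct Hrho as (_ & _ & Hrho). lra.
      + intros y Hy. apply Hmax. assert (T := Cmod_le_minus_plus y a). lra.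
    - specialize (Hmax z Hzr). specialize (FM a). specialize (H1 a). rewrite E in *.
      assert (HFa : Cmod (F a) <= / r).
      { apply (Rmult_le_reg_l r); [lra|]. rewrite Rinv_r by lra. lra. }
      assert (HF2 : Cmod (F a) ^ 2 <= (/ r) ^ 2).
      { apply pow_incr. split; [apply Cmod_ge_0|exact HFa]. }
      assert (0 <= 2 * eps * Cmod z ^ 2).
      { apply Rmult_le_pos; [lra|]. apply pow2_ge_0. }
      assert (Hr2 : r ^ 2 <= 1) by (simpl; nra).
      assert (2 * eps * r ^ 2 <= 2 * eps) by nra. lra. }
  rewrite FM. assert (HF : Cmod (F z) <= 1).
  { apply Rnot_lt_le. intros HF.
    set (q := Cmod (F z)) in *.
    (* If [q > 1], then [1 / r <= (1 + q) / 2] and [eps = (q - 1) / 8] turn the bound into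
       [q^2 <= ((1 + q) / 2)^2 + (q - 1) / 4], which is false. *)
    set (r := Rmax (Rmax (Cmod z) (1 / 2)) (2 / (1 + q))).
    assert (Hq : 2 / (1 + q) < 1) by (apply Rlt_div_l; lra).
    assert (Hr : Cmod z <= r /\ 1 / 2 <= r /\ 2 / (1 + q) <= r).
    { unfold r. repeat split; [eapply Rle_trans; [|apply Rmax_l]; apply Rmax_l|
        eapply Rle_trans; [|apply Rmax_l]; apply Rmax_r|apply Rmax_r]. }
    assert (Hr1 : r < 1) by (unfold r; repeat apply Rmax_lub_lt; lra).
    assert (Hir : / r <= (1 + q) / 2).
    { replace ((1 + q) / 2) with (/ (2 / (1 + q))) by (field; lra).
      apply Rinv_le_contravar; [apply Rdiv_lt_0_compat; lra|apply Hr]. }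
    assert (Hir0 : 0 < / r) by (apply Rinv_0_lt_compat; lra).
    specialize (Hbound r ((q - 1) / 8)). nra. }
  assert (H2 := Cmod_ge_0 z). nra.
Qed.

(** * The nephroid domain *)

Lemma phi_Ne_minus (a b : C) :
  (phi_Ne a - phi_Ne b)%C = ((a - b) * (1 - (a * a + a * b + b * b) / 3))%C.
Proof. unfold phi_Ne. field. Qed.

Lemma is_C_derive_phi_Ne z : is_C_derive phi_Ne z (1 - z * z)%C.
Proof.
  apply (is_C_derive_ext (fun x => 1 + x - x * x * x * / 3)%C).
  - intros y. unfold phi_Ne. change (@eq C (1 + y - y * y * y * / 3)%C (1 + y - y ^ 3 / 3)%C).
    field.
  - eapply is_C_derive_eq.
    + C_derive_rules.
    + cbv beta. field.
Qed.

Lemma Cmod_quadratic_form_le (a b : C) r : Cmod a <= r -> Cmod b <= r ->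
  Cmod (a * a + a * b + b * b) <= 3 * r ^ 2.
Proof.
  intros Ha Hb. assert (H1 := Cmod_ge_0 a). assert (H2 := Cmod_ge_0 b).
  eapply Rle_trans; [apply Cmod_triangle|]. rewrite Cmod_mult.
  assert (H := Cmod_triangle (a * a) (a * b)). rewrite !Cmod_mult in H. nra.
Qed.

Lemma Cmod_1_minus_ge (a : C) : 1 - Cmod a <= Cmod (1 - a).
Proof.
  assert (H := Cmod_triangle (1 - a) a). replace (1 - a + a)%C with (RtoC 1) in H by ring.
  rewrite Cmod_1 in H. lra.
Qed.

Lemma Cmod_3 : Cmod 3 = 3.
Proof. rewrite Cmod_R. apply Rabs_pos_eq. lra. Qed.

Lemma C3_neq_0 : RtoC 3 <> RtoC 0.
Proof. intros E. apply RtoC_inj in E. lra. Qed.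

(** In the factorisation the cofactor of [a - b] cannot vanish, since [|a^2 + a b + b^2| < 3] in the
    open disk. *)
Lemma phi_Ne_inj (a b : C) : Cmod a < 1 -> Cmod b < 1 -> phi_Ne a = phi_Ne b -> a = b.
Proof.
  intros Ha Hb E. assert (H := phi_Ne_minus a b). rewrite E in H.
  replace (phi_Ne b - phi_Ne b)%C with (RtoC 0) in H by ring.
  assert (Hr : Rmax (Cmod a) (Cmod b) < 1) by now apply Rmax_lub_lt.
  assert (Hq := Cmod_quadratic_form_le a b _ (Rmax_l _ _) (Rmax_r _ _)).
  assert (H1 := Cmod_1_minus_ge ((a * a + a * b + b * b) / 3)).
  rewrite Cmod_div, Cmod_3 in H1 by apply C3_neq_0.
  assert (Hr0 : 0 <= Rmax (Cmod a) (Cmod b)) by (eapply Rle_trans; [apply Cmod_ge_0|apply Rmax_l]).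
  apply (f_equal Cmod) in H. rewrite Cmod_0, Cmod_mult in H.
  symmetry in H. apply Rmult_integral in H as [H|H].
  - apply Cmod_eq_0 in H. replace a with (a - b + b)%C by ring. rewrite H. ring.
  - exfalso. simpl in Hq. nra.
Qed.

(* A minimiser [w] of [|phi_Ne w - 1 - u|] over a disk preserved by the contraction
   [w |-> u + w^3 / 3] must be a fixed point, since the contraction decreases this modulus. *)
Lemma phi_Ne_onto (u : C) : Cmod u < 2 / 3 -> exists w, Cmod w < 1 /\ phi_Ne w = (1 + u)%C.
Proof.
  (* As [r - |u| = 1 / 3], the contraction preserves the disk of radius [r] as soon as [r <= 1];
     [|u| < 2 / 3] is exactly [r < 1]. *)
  intros Hu. assert (Hu0 := Cmod_ge_0 u). set (r := 1 / 3 + Cmod u).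
  assert (Hr : Cmod u + r ^ 3 / 3 <= r).
  { unfold r. simpl. nra. }
  set (err := fun w => (phi_Ne w - (1 + u))%C).
  assert (Herr : forall w, exists l, is_C_derive err w l).
  { intros w. eexists. apply is_C_derive_minus; [apply is_C_derive_phi_Ne|apply is_C_derive_const]. }
  destruct (disk_attains_max (fun w => - Cmod (err w)) r) as (w & Hw & Hmax).
  - unfold r; lra.
  - intros z _ eps Heps. destruct (Herr z) as [l Hl].
    destruct (is_C_derive_continuous _ _ _ Hl eps Heps) as [d [Hd Hc]].
    exists d; split; trivial. intros y _ Hy.
    replace (- Cmod (err y) - - Cmod (err z))
      with (- (Cmod (err y) - Cmod (err z))) by ring.
    rewrite Rabs_Ropp. eapply Rle_lt_trans; [apply Cmod_minus_Cmod_le|now apply Hc].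
  - exists w. split; [unfold r in Hw; lra|].
    set (w' := (u + w * w * w / 3)%C).
    assert (Hw0 := Cmod_ge_0 w).
    assert (Hw' : Cmod w' <= r).
    { unfold w'. eapply Rle_trans; [apply Cmod_triangle|].
      rewrite Cmod_div, Cmod_3, !Cmod_mult by apply C3_neq_0.
      assert (Cmod w * Cmod w * Cmod w <= r ^ 3).
      { replace (Cmod w * Cmod w * Cmod w) with (Cmod w ^ 3) by ring. now apply pow_incr. }
      lra. }
    specialize (Hmax w' Hw').
    assert (E1 : err w = (w - w')%C) by (unfold err, w', phi_Ne; field).
    (* The new error is the old one times a factor of modulus at most [r ^ 2 < 1], so minimality
       forces the error to vanish. *)
    assert (E2 : err w' = ((w - w') * ((w * w + w * w' + w' * w') / 3))%C).
    { transitivity (phi_Ne w' - phi_Ne w + err w)%C; [unfold err; ring|].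
      rewrite phi_Ne_minus, E1. field. }
    rewrite E1, E2, Cmod_mult, Cmod_div, Cmod_3 in Hmax by apply C3_neq_0.
    assert (Hq := Cmod_quadratic_form_le w w' r Hw Hw').
    assert (Hr1 : r ^ 2 < 1).
    { assert (r < 1) by (unfold r; lra). assert (0 < r) by (unfold r; lra). simpl; nra. }
    assert (Hd := Cmod_ge_0 (w - w')).
    assert (H0 : Cmod (w - w') = 0) by nra.
    apply Cmod_eq_0 in H0. rewrite <- E1 in H0. unfold err in H0.
    replace (phi_Ne w) with (phi_Ne w - (1 + u) + (1 + u))%C by ring. rewrite H0. ring.
Qed.

(** The factorisation makes [W] Lipschitz near [u] with constant [1 / m], and the remainder of the
    expected derivative contains [(W y - W u)^2], hence is quadratic in [y - u]. *)
Lemma phi_Ne_inverse_derivable (W : C -> C) :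
  (forall u, Cmod u < 2 / 3 -> Cmod (W u) < 1 /\ phi_Ne (W u) = (1 + u)%C) ->
  forall u, Cmod u < 2 / 3 -> is_C_derive W u (/ (1 - W u * W u))%C.
Proof.
  intros HW u Hu. destruct (HW u Hu) as [Hw Ew]. set (w := W u) in *.
  assert (Hw0 := Cmod_ge_0 w).
  (* A lower bound for [|1 - (v^2 + v w + w^2) / 3|] uniform over [|v| < 1], positive because
     [|w| < 1]. *)
  set (m := 1 - (1 + Cmod w + Cmod w ^ 2) / 3).
  assert (Hm : 0 < m) by (unfold m; simpl; nra).
  assert (Hdn : (1 - w * w)%C <> RtoC 0).
  { apply Cmod_gt_0. assert (H := Cmod_1_minus_ge (w * w)). rewrite Cmod_mult in H. nra. }
  set (k := Cmod (1 - w * w)). assert (Hk : 0 < k) by now apply Cmod_gt_0.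
  apply is_C_derive_eps. intros eps Heps.
  exists (Rmin (2 / 3 - Cmod u) (eps * (m ^ 2 * k))). split.
  { apply Rmin_pos; [lra|]. assert (0 < m ^ 2) by now apply pow_lt.
    apply Rmult_lt_0_compat; trivial. now apply Rmult_lt_0_compat. }
  intros y Hy. assert (Hy1 := Rlt_le_trans _ _ _ Hy (Rmin_l _ _)).
  assert (Hy2 := Rlt_le_trans _ _ _ Hy (Rmin_r _ _)).
  assert (T := Cmod_le_minus_plus y u).
  destruct (HW y) as [Hv Ev]; [lra|]. set (v := W y) in *.
  assert (Hv0 := Cmod_ge_0 v).
  assert (Ed : (y - u)%C = ((v - w) * (1 - (v * v + v * w + w * w) / 3))%C).
  { rewrite <- phi_Ne_minus, Ew, Ev. ring. }
  assert (Hlip : Cmod (v - w) * m <= Cmod (y - u)).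
  { rewrite Ed, Cmod_mult. apply Rmult_le_compat_l; [apply Cmod_ge_0|].
    eapply Rle_trans; [|apply Cmod_1_minus_ge]. rewrite Cmod_div, Cmod_3 by apply C3_neq_0.
    assert (H1 := Cmod_triangle (v * v + v * w) (w * w)).
    assert (H2 := Cmod_triangle (v * v) (v * w)).
    rewrite (Cmod_mult w w) in H1. rewrite (Cmod_mult v v), (Cmod_mult v w) in H2.
    assert (Cmod v * Cmod v <= 1) by nra. assert (Cmod v * Cmod w <= Cmod w) by nra.
    unfold m. simpl. lra. }
  change (W u) with w.
  replace (v - w - (y - u) * / (1 - w * w))%C
    with ((v - w) * (v - w) * (v + 2 * w) / 3 / (1 - w * w))%C
    by (rewrite Ed; field; exact Hdn).
  rewrite !Cmod_div, Cmod_3, !Cmod_mult by (exact Hdn || apply C3_neq_0). fold k.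
  assert (H3 : Cmod (v + 2 * w) <= 3).
  { eapply Rle_trans; [apply Cmod_triangle|]. rewrite Cmod_mult, Cmod_R, Rabs_pos_eq by lra. lra. }
  assert (Hvw := Cmod_ge_0 (v - w)). assert (Hyu := Cmod_ge_0 (y - u)).
  apply Rle_div_l; [exact Hk|].
  assert (H4 : Cmod (v - w) * Cmod (v - w) * Cmod (v + 2 * w) / 3 <= Cmod (v - w) ^ 2).
  { assert (0 <= Cmod (v - w) * Cmod (v - w)) by nra. simpl. nra. }
  eapply Rle_trans; [exact H4|].
  apply (Rmult_le_reg_r (m ^ 2)); [now apply pow_lt|].
  assert (H5 : (Cmod (v - w) * m) ^ 2 <= Cmod (y - u) ^ 2).
  { apply pow_incr. split; [nra|exact Hlip]. }
  assert (H6 : Cmod (y - u) ^ 2 <= Cmod (y - u) * (eps * (m ^ 2 * k))).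
  { simpl. rewrite Rmult_1_r. apply Rmult_le_compat_l; lra. }
  replace (Cmod (v - w) ^ 2 * m ^ 2) with ((Cmod (v - w) * m) ^ 2) by ring.
  lra.
Qed.

Lemma disk_subordinate_phi_Ne (p : C -> C) :
  analytic_on_D p -> p (RtoC 0) = RtoC 1 -> (forall z, in_D z -> Cmod (p z - 1) < 2 / 3) ->
  subordinate p phi_Ne.
Proof.
  intros Hp Hp0 Hb. split; [exact Hp|]. split.
  { intros z _. eexists. apply is_C_derive_phi_Ne. }
  (* The bound on [u] sits under the existential so that choice yields a total inverse; 0 is a
     filler outside the disk. *)
  assert (HE : forall u, exists w, Cmod u < 2 / 3 -> Cmod w < 1 /\ phi_Ne w = (1 + u)%C).
  { intros u. destruct (Rlt_dec (Cmod u) (2 / 3)) as [H|H].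
    - destruct (phi_Ne_onto u H) as [w Hw]. now exists w.
    - exists (RtoC 0). intros; contradiction. }
  set (W := fun u => proj1_sig (constructive_indefinite_description _ (HE u))).
  assert (HW : forall u, Cmod u < 2 / 3 -> Cmod (W u) < 1 /\ phi_Ne (W u) = (1 + u)%C).
  { intros u. exact (proj2_sig (constructive_indefinite_description _ (HE u))). }
  exists (fun z => W (p z - 1)%C). split; [|split; [|split]].
  - intros z Hz. destruct (Hp z Hz) as [l Hl]. eexists.
    apply (is_C_derive_comp W (fun z => p z - 1)%C).
    + apply phi_Ne_inverse_derivable; [exact HW|now apply Hb].
    + apply is_C_derive_minus; [exact Hl|apply is_C_derive_const].
  - rewrite Hp0. replace (1 - 1)%C with (RtoC 0) by ring.
    destruct (HW (RtoC 0)) as [H1 H2]; [rewrite Cmod_0; lra|].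
    apply phi_Ne_inj; trivial; [rewrite Cmod_0; lra|]. rewrite H2. unfold phi_Ne. field.
  - intros z Hz. now apply HW, Hb.
  - intros z Hz. destruct (HW (p z - 1)%C (Hb z Hz)) as [_ E]. rewrite E. ring.
Qed.

(** [phi_Ne] has real coefficients, so a real value and injectivity force [w] to equal its
    conjugate. For real [t] the gap is [5 / 3 - phi_Ne t = (1 - t)^2 (2 + t) / 3]. *)
Lemma phi_Ne_real_lt (w : C) (x : R) : Cmod w < 1 -> phi_Ne w = RtoC x -> x < 5 / 3.
Proof.
  intros Hw E.
  assert (Ec : phi_Ne (Cconj w) = phi_Ne w).
  { rewrite E. replace (RtoC x) with (Cconj (RtoC x)) by (unfold Cconj, RtoC; simpl; f_equal; ring).
    rewrite <- E. unfold phi_Ne. destruct w as [a b].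
    unfold Cconj, Cdiv, Cinv, Cminus, Cplus, Copp, Cmult, RtoC; simpl. f_equal; field. }
  apply phi_Ne_inj in Ec; trivial; [|now rewrite Cmod_conj].
  destruct w as [t s]. assert (s = 0) by (injection Ec; lra). subst s.
  change ((t, 0) : C) with (RtoC t) in *. rewrite Cmod_R in Hw. apply Rabs_lt_between in Hw.
  assert (Ex : x = 1 + t - t ^ 3 / 3).
  { apply RtoC_inj. rewrite <- E. unfold phi_Ne.
    unfold Cconj, Cdiv, Cinv, Cminus, Cplus, Copp, Cmult, RtoC; simpl. f_equal; field. }
  assert (0 < (1 - t) ^ 2 * (2 + t)) by (apply Rmult_lt_0_compat; [apply pow_lt|]; lra).
  simpl in *. lra.
Qed.

(** * The entire exponential integral and the implications *)

Definition expm1_coef (n : nat) : R := / INR (fact (S n)).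

(* [expm1_quot x = (exp x - 1) / x], with the value [1] at [x = 0]. *)
Definition expm1_quot (x : R) : R := PSeries expm1_coef x.

(** The primitive of [expm1_quot] vanishing at 0. In the usual sign convention for the entire
    exponential integral this is minus its value at [- x]. *)
Definition Ein (x : R) : R := PSeries (PS_Int expm1_coef) x.

Lemma CV_radius_expm1_coef : CV_radius expm1_coef = p_infty.
Proof.
  apply CV_radius_infinite_DAlembert.
  - intros n. apply Rinv_neq_0_compat. apply INR_fact_neq_0.
  - apply (is_lim_seq_ext (fun n => / INR (n + 2))).
    + intros n. replace (n + 2)%nat with (S (S n)) by lia. unfold expm1_coef.
      assert (H1 := INR_fact_neq_0 (S n)). assert (H2 : INR (S (S n)) <> 0) by now apply not_0_INR.
      change (fact (S (S n))) with (S (S n) * fact (S n))%nat. rewrite mult_INR.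
      replace (/ (INR (S (S n)) * INR (fact (S n))) / / INR (fact (S n))) with (/ INR (S (S n)))
        by (field; now split).
      rewrite Rabs_pos_eq; trivial. left. apply Rinv_0_lt_compat. now apply lt_0_INR; lia.
    + apply -> (is_lim_seq_incr_n (fun n => / INR n) 2).
      apply (is_lim_seq_inv INR p_infty); [apply is_lim_seq_INR|discriminate].
Qed.

Lemma expm1_quot_mult x : x * expm1_quot x = exp x - 1.
Proof.
  rewrite exp_Reals, (PSeries_decr_1 (fun n => / INR (fact n))).
  - change (PS_decr_1 (fun n => / INR (fact n))) with expm1_coef. unfold expm1_quot. simpl. field.
  - apply (ex_pseries_ext (fun n => / INR (fact n))); [trivial|].
    eexists. apply is_exp_Reals.
Qed.

Lemma expm1_quot_continuous x : continuity_pt expm1_quot x.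
Proof. apply PSeries_continuity. now rewrite CV_radius_expm1_coef. Qed.

Lemma expm1_quot_0 : expm1_quot 0 = 1.
Proof. unfold expm1_quot. rewrite PSeries_0. unfold expm1_coef. simpl. field. Qed.

Lemma expm1_quot_pos x : 0 <= x -> 0 < expm1_quot x.
Proof.
  intros [Hx|<-]; [|rewrite expm1_quot_0; lra].
  assert (H := expm1_quot_mult x). assert (H1 := exp_ineq1 x). nra.
Qed.

Lemma is_derive_Ein x : is_derive Ein x (expm1_quot x).
Proof.
  replace (expm1_quot x) with (PSeries (PS_derive (PS_Int expm1_coef)) x).
  - apply is_derive_PSeries. now rewrite CV_radius_Int, CV_radius_expm1_coef.
  - apply PSeries_ext. intros n. unfold PS_derive, PS_Int. field. now apply not_0_INR.
Qed.

Lemma Ein_0 : Ein 0 = 0.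
Proof. unfold Ein. rewrite PSeries_0. reflexivity. Qed.

Lemma Ein_1 : Ein 1 = Series (fun n => 1 / (INR (S n) * INR (fact (S n)))).
Proof.
  (* The primitive has zero constant term, which produces the index shift of the constants. *)
  unfold Ein, PSeries. rewrite Series_incr_1_aux by (simpl; ring).
  apply Series_ext. intros n. rewrite pow1. unfold PS_Int, expm1_coef.
  field. split; [apply INR_fact_neq_0|now apply not_0_INR].
Qed.

Lemma Ein_lt x y : 0 <= x < y -> Ein x < Ein y.
Proof.
  intros H. destruct (MVT_cor2 Ein expm1_quot x y) as [c [E Hc]]; [lra| |].
  - intros t _. apply is_derive_Reals, is_derive_Ein.
  - assert (H1 := expm1_quot_pos c). nra.
Qed.

Lemma is_derive_Ein_ray b r t : is_derive (fun t => Ein (t * r) / b) t (r * expm1_quot (t * r) / b).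
Proof.
  unfold Rdiv. apply (is_derive_ext (fun t => / b * Ein (t * r))); [intros; apply Rmult_comm|].
  replace (r * expm1_quot (t * r) * / b) with (/ b * (r * expm1_quot (t * r))) by ring.
  apply is_derive_scal. apply (is_derive_comp Ein (fun t => t * r)).
  - apply is_derive_Ein.
  - auto_derive; trivial. ring.
Qed.

Lemma ray_in_D z t : in_D z -> 0 <= t <= 1 -> in_D (RtoC t * z).
Proof.
  unfold in_D. intros Hz Ht. rewrite Cmod_mult, Cmod_R, Rabs_pos_eq by lra.
  assert (H := Cmod_ge_0 z). nra.
Qed.

(** The hypothesis at the point [t z] has a factor [t] on both sides; dividing it out leaves the
    derivative in [t] of [Ein (t |z|) / b]. *)
Lemma ray_derive_bound (b t : R) (z d : C) : 0 < b -> 0 < t < 1 ->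
  Cmod (RtoC t * z * d) <= (exp (Cmod (RtoC t * z)) - 1) / b ->
  Cmod (z * d) <= Cmod z * expm1_quot (t * Cmod z) / b.
Proof.
  intros Hb Ht H. rewrite <- Cmult_assoc in H.
  rewrite Cmod_mult, (Cmod_mult t z), Cmod_R, Rabs_pos_eq in H by lra.
  rewrite <- expm1_quot_mult in H.
  replace (t * Cmod z * expm1_quot (t * Cmod z) / b) with
    (t * (Cmod z * expm1_quot (t * Cmod z) / b)) in H by (field; lra).
  apply (Rmult_le_reg_l t); lra.
Qed.

(** Serves (a) with [q = p], (c) with [q = 1 / p], and the bound on [CEin] with [b = 1]. *)
Lemma Ein_bound (b : R) (q q' : C -> C) : 0 < b ->
  (forall z, in_D z -> is_C_derive q z (q' z)) ->
  (forall z, in_D z -> Cmod (z * q' z) <= (exp (Cmod z) - 1) / b) ->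
  forall z, in_D z -> Cmod (q z - q (RtoC 0)) <= Ein (Cmod z) / b.
Proof.
  intros Hb Hd Hle z Hz.
  assert (H := curve_mean_value (fun t => q (RtoC t * z)%C) (fun t => z * q' (RtoC t * z)%C)%C
    (fun t => Ein (t * Cmod z) / b) (fun t => Cmod z * expm1_quot (t * Cmod z) / b)).
  cbv beta in H. rewrite Cmult_1_l, Cmult_0_l, Rmult_1_l, Rmult_0_l, Ein_0 in H.
  replace (Ein (Cmod z) / b) with (Ein (Cmod z) / b - 0 / b) by (field; lra).
  apply H; intros t Ht.
  - apply (curve_derive_comp q (fun t => RtoC t * z)%C); [|apply curve_derive_ray].
    now apply Hd, ray_in_D.
  - apply is_derive_Ein_ray.
  - apply ray_derive_bound; trivial. apply Hle, ray_in_D; trivial. lra.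
Qed.

(** A Gronwall argument in two rounds: the bound on [p' / p] first controls [|p|] by
    [exp (Ein / b)]; then the speed of [p] along the ray is at most the derivative of that
    exponential. *)
Lemma exp_Ein_bound (b : R) (p p' : C -> C) : 0 < b -> p (RtoC 0) = RtoC 1 ->
  (forall z, in_D z -> is_C_derive p z (p' z)) -> (forall z, in_D z -> p z <> RtoC 0) ->
  (forall z, in_D z -> Cmod (z * (p' z / p z)) <= (exp (Cmod z) - 1) / b) ->
  forall z, in_D z -> Cmod (p z - 1) <= exp (Ein (Cmod z) / b) - 1.
Proof.
  intros Hb Hp0 Hd Hn Hle.
  assert (Hray : forall z t, in_D z -> 0 < t < 1 -> Cmod (z * p' (RtoC t * z)%C) <=
      Cmod z * expm1_quot (t * Cmod z) / b * Cmod (p (RtoC t * z)%C)).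
  { intros z t Hz Ht. assert (Htz : in_D (RtoC t * z)) by (apply ray_in_D; trivial; lra).
    assert (H := ray_derive_bound b t z _ Hb Ht (Hle _ Htz)).
    replace (z * p' (RtoC t * z)%C)%C with
      (z * (p' (RtoC t * z)%C / p (RtoC t * z)%C) * p (RtoC t * z)%C)%C by (field; now apply Hn).
    rewrite Cmod_mult. apply Rmult_le_compat_r; [apply Cmod_ge_0|exact H]. }
  assert (Hcurve : forall z t, in_D z -> 0 <= t <= 1 ->
    curve_derive (fun t => p (RtoC t * z)%C) t (z * p' (RtoC t * z)%C)%C).
  { intros z t Hz Ht.
    apply (curve_derive_comp p (fun t => RtoC t * z)%C); [|apply curve_derive_ray].
    now apply Hd, ray_in_D. }
  assert (Hmod : forall z, in_D z -> Cmod (p z) <= exp (Ein (Cmod z) / b)).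
  { intros z Hz.
    (* [|p|^2 exp (- 2 Ein / b)] is nonincreasing along the ray. *)
    set (e := fun t => Ein (t * Cmod z) / b).
    set (e' := fun t => Cmod z * expm1_quot (t * Cmod z) / b).
    set (u := fun t => Re (p (RtoC t * z)%C)). set (v := fun t => Im (p (RtoC t * z)%C)).
    set (u' := fun t => Re (z * p' (RtoC t * z)%C)%C).
    set (v' := fun t => Im (z * p' (RtoC t * z)%C)%C).
    assert (H := mean_value_le (fun t => - ((u t * u t + v t * v t) * exp (- (2 * e t))))
      (fun t => (e' t * (u t * u t + v t * v t) - (u t * u' t + v t * v' t))
         * (2 * exp (- (2 * e t))))).
    assert (U0 : u 0 = 1) by (unfold u; now rewrite Cmult_0_l, Hp0).
    assert (V0 : v 0 = 0) by (unfold v; now rewrite Cmult_0_l, Hp0).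
    assert (E0 : e 0 = 0) by (unfold e; rewrite Rmult_0_l, Ein_0; field; lra).
    cbv beta in H. rewrite U0, V0, E0 in H.
    replace (- (2 * 0)) with 0 in H by ring. rewrite exp_0 in H.
    assert (E1 : u 1 * u 1 + v 1 * v 1 = Cmod (p z) ^ 2).
    { unfold u, v. rewrite Cmult_1_l, Cmod2_alt. simpl; ring. }
    assert (E2 : e 1 = Ein (Cmod z) / b) by (unfold e; now rewrite Rmult_1_l).
    rewrite E1, E2 in H.
    assert (H' : Cmod (p z) ^ 2 * exp (- (2 * (Ein (Cmod z) / b))) <= 1).
    { enough (- ((1 * 1 + 0 * 0) * 1) <= - (Cmod (p z) ^ 2 * exp (- (2 * (Ein (Cmod z) / b)))))
        by lra.
      apply H; intros t Ht.
      - destruct (Hcurve z t Hz Ht) as [D1 D2].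
        assert (D3 : is_derive e t (e' t)) by apply is_derive_Ein_ray.
        change (is_derive u t (u' t)) in D1. change (is_derive v t (v' t)) in D2.
        auto_derive.
        + repeat split; eexists; eassumption.
        + replace (Derive (fun x => u x) t) with (u' t) by (symmetry; now apply is_derive_unique).
          replace (Derive (fun x => v x) t) with (v' t) by (symmetry; now apply is_derive_unique).
          replace (Derive (fun x => e x) t) with (e' t) by (symmetry; now apply is_derive_unique).
          ring.
      - apply Rmult_le_pos; [|assert (He := exp_pos (- (2 * e t))); lra].
        assert (Hr := Re_Cconj_mult_le (p (RtoC t * z)%C) (z * p' (RtoC t * z))%C).
        specialize (Hray z t Hz Ht). fold (e' t) in Hray.
        assert (Hc := Cmod2_alt (p (RtoC t * z)%C)). assert (H0 := Cmod_ge_0 (p (RtoC t * z)%C)).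
        apply (Rmult_le_compat_l _ _ _ H0) in Hray.
        unfold u, v, u', v'.
        replace (_ * _ + _ * _) with (Cmod (p (RtoC t * z)%C) ^ 2) by (rewrite Hc; ring).
        lra. }
    replace (- (2 * (Ein (Cmod z) / b))) with (- (Ein (Cmod z) / b) + - (Ein (Cmod z) / b)) in H'
      by ring.
    rewrite exp_plus, exp_Ropp in H'. set (x := exp (Ein (Cmod z) / b)) in *.
    assert (Hx : 0 < x) by apply exp_pos. assert (Hx' := Rinv_0_lt_compat _ Hx).
    assert (H3 : Cmod (p z) * / x <= 1).
    { assert (H4 := Cmod_ge_0 (p z)). assert (0 <= Cmod (p z) * / x) by nra. nra. }
    apply (Rmult_le_reg_r (/ x)); trivial. rewrite Rinv_r by lra. exact H3. }
  intros z Hz.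
  assert (H := curve_mean_value (fun t => p (RtoC t * z)%C) (fun t => z * p' (RtoC t * z)%C)%C
    (fun t => exp (Ein (t * Cmod z) / b))
    (fun t => Cmod z * expm1_quot (t * Cmod z) / b * exp (Ein (t * Cmod z) / b))).
  cbv beta in H. rewrite Cmult_1_l, Cmult_0_l, Rmult_1_l, Rmult_0_l, Ein_0, Hp0 in H.
  replace (0 / b) with 0 in H by (field; lra). rewrite exp_0 in H.
  apply H; intros t Ht.
  - now apply Hcurve.
  - apply (is_derive_comp exp (fun t => Ein (t * Cmod z) / b)); [apply is_derive_exp|].
    apply is_derive_Ein_ray.
  - eapply Rle_trans; [now apply Hray|]. apply Rmult_le_compat_l.
    + apply Rdiv_le_0_compat; trivial. assert (H0 := Cmod_ge_0 z).
      assert (H1 := expm1_quot_pos (t * Cmod z)). nra.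
    + assert (Ht' : 0 <= t <= 1) by lra. assert (Hm := Hmod _ (ray_in_D z t Hz Ht')).
      rewrite (Cmod_mult t), Cmod_R, Rabs_pos_eq in Hm by lra. exact Hm.
Qed.

(** * The constants and the three implications *)

Lemma beta_a_Ein : beta_a = 3 / 2 * Ein 1.
Proof.
  rewrite Ein_1. unfold beta_a. rewrite <- Series_scal_l. apply Series_ext. intros n.
  field. split; [apply INR_fact_neq_0|now apply not_0_INR].
Qed.

Lemma ln_5_3_pos : 0 < ln (5 / 3).
Proof. rewrite <- ln_1. apply ln_increasing; lra. Qed.

Lemma beta_b_Ein : beta_b = Ein 1 / ln (5 / 3).
Proof. rewrite Ein_1. unfold beta_b. field. apply Rgt_not_eq, ln_5_3_pos. Qed.

Lemma beta_c_Ein : beta_c = 5 / 2 * Ein 1.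
Proof.
  rewrite Ein_1. unfold beta_c. rewrite <- Series_scal_l. apply Series_ext. intros n.
  field. split; [apply INR_fact_neq_0|now apply not_0_INR].
Qed.

Lemma subordinate_phi_e_bound (b : R) (f : C -> C) : 0 < b ->
  subordinate (fun z => 1 + b * f z)%C phi_e ->
  forall z, in_D z -> Cmod (f z) <= (exp (Cmod z) - 1) / b.
Proof.
  intros Hb (_ & _ & w & Hw & Hw0 & Hw1 & E) z Hz.
  specialize (E z Hz). assert (Hs := schwarz_lemma w Hw Hw0 Hw1 z Hz).
  assert (Hf : (b * f z)%C = (Cexp (w z) - 1)%C).
  { unfold phi_e in E. rewrite <- E. ring. }
  apply (f_equal Cmod) in Hf. rewrite Cmod_mult, Cmod_R, Rabs_pos_eq in Hf by lra.
  assert (H1 := Cmod_Cexp_minus_1_le (w z)).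
  assert (H2 : exp (Cmod (w z)) <= exp (Cmod z)).
  { destruct Hs as [Hs|Hs]; [left; now apply exp_increasing|right; now rewrite Hs]. }
  apply Rle_div_r; lra.
Qed.

Lemma Ein_1_pos : 0 < Ein 1.
Proof. rewrite <- Ein_0. apply Ein_lt; lra. Qed.

(** Strict even at the extreme [b], because [|z| < 1] and [Ein] increases. The implications take
    [k = 2 / 3], [ln (5 / 3)] and [2 / 5]. *)
Lemma Ein_div_lt (z : C) k b : in_D z -> 0 < k -> Ein 1 / k <= b -> Ein (Cmod z) / b < k.
Proof.
  intros Hz Hk Hb. assert (H0 := Ein_1_pos).
  assert (0 < b) by (eapply Rlt_le_trans; [|exact Hb]; now apply Rdiv_lt_0_compat).
  assert (H1 : Ein (Cmod z) < Ein 1) by (apply Ein_lt; split; [apply Cmod_ge_0|exact Hz]).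
  apply Rlt_div_l; trivial. apply Rle_div_l in Hb; trivial. lra.
Qed.

Lemma C_derive_spec (p : C -> C) : analytic_on_D p ->
  forall z, in_D z -> is_C_derive p z (C_derive p z).
Proof. intros Hp z Hz. now apply C_derive_correct; [exact z|apply Hp]. Qed.

Lemma implication_a : implication_from dsub_a beta_a.
Proof.
  intros p b Hp Hp0 Hb Hs. apply disk_subordinate_phi_Ne; trivial. intros z Hz.
  rewrite beta_a_Ein in Hb. assert (H1 := Ein_1_pos).
  rewrite <- Hp0. eapply Rle_lt_trans.
  - apply (Ein_bound b p (C_derive p)); [lra|now apply C_derive_spec| |exact Hz].
    apply (subordinate_phi_e_bound b (fun z => z * C_derive p z)%C); [lra|exact Hs].
  - apply Ein_div_lt; trivial; lra.
Qed.

Lemma implication_b : implication_from dsub_b beta_b.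
Proof.
  intros p b Hp Hp0 Hb [Hn Hs]. apply disk_subordinate_phi_Ne; trivial. intros z Hz.
  rewrite beta_b_Ein in Hb. assert (H1 := Ein_1_pos). assert (H2 := ln_5_3_pos).
  assert (H3 : 0 < Ein 1 / ln (5 / 3)) by now apply Rdiv_lt_0_compat.
  eapply Rle_lt_trans.
  - apply (exp_Ein_bound b p (C_derive p)); trivial; [lra|now apply C_derive_spec|].
    intros y Hy. replace (y * (C_derive p y / p y))%C with (y * C_derive p y / p y)%C
      by (unfold Cdiv; ring).
    apply (subordinate_phi_e_bound b (fun z => z * C_derive p z / p z)%C); trivial. lra.
  - assert (H4 := Ein_div_lt z _ b Hz H2 Hb). apply exp_increasing in H4.
    rewrite exp_ln in H4; lra.
Qed.

Lemma implication_c : implication_from dsub_c beta_c.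
Proof.
  intros p b Hp Hp0 Hb [Hn Hs]. apply disk_subordinate_phi_Ne; trivial. intros z Hz.
  rewrite beta_c_Ein in Hb. assert (H1 := Ein_1_pos).
  assert (HI : Cmod (/ p z - 1) < 2 / 5).
  { replace (RtoC 1) with (/ p (RtoC 0))%C by (rewrite Hp0; field).
    eapply Rle_lt_trans.
    - apply (Ein_bound b (fun z => / p z)%C (fun z => - C_derive p z / p z ^ 2)%C); [lra| | |exact Hz].
      + intros y Hy. apply is_C_derive_inv; [now apply C_derive_spec|now apply Hn].
      + intros y Hy. replace (y * (- C_derive p y / p y ^ 2))%C
          with (- (y * C_derive p y / p y ^ 2))%C by (unfold Cdiv; ring).
        rewrite Cmod_opp.
        apply (subordinate_phi_e_bound b (fun z => z * C_derive p z / p z ^ 2)%C); trivial. lra.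
    - apply Ein_div_lt; trivial; lra. }
  set (q := (/ p z)%C) in *.
  (* [|p - 1| = |q - 1| / |q|] is below [(2 / 5) / (3 / 5) = 2 / 3], which explains the factor
     [5 / 2] in [beta_c]. *)
  assert (Hq : 3 / 5 < Cmod q).
  { assert (T := Cmod_triangle (- (q - 1)) q). rewrite Cmod_opp in T.
    replace (- (q - 1) + q)%C with (RtoC 1) in T by ring. rewrite Cmod_1 in T. lra. }
  assert (Hq0 : q <> RtoC 0) by (apply Cmod_gt_0; lra).
  replace (p z - 1)%C with (- (q - 1) / q)%C.
  - rewrite Cmod_div, Cmod_opp by trivial. apply Rlt_div_l; lra.
  - unfold q. field. now apply Hn.
Qed.

(** * Sharpness *)

Definition ex_CInt (f : R -> C) : Prop :=
  ex_RInt (fun t => Re (f t)) 0 1 /\ ex_RInt (fun t => Im (f t)) 0 1.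

Definition CInt (f : R -> C) : C :=
  (RInt (fun t => Re (f t)) 0 1, RInt (fun t => Im (f t)) 0 1).

Lemma CInt_ext (f g : R -> C) : (forall t, f t = g t) -> CInt f = CInt g.
Proof.
  intros H. unfold CInt. f_equal; apply RInt_ext; intros t _; now rewrite H.
Qed.

Lemma CInt_minus (f g : R -> C) : ex_CInt f -> ex_CInt g ->
  ex_CInt (fun t => f t - g t)%C /\ CInt (fun t => f t - g t)%C = (CInt f - CInt g)%C.
Proof.
  intros [F1 F2] [G1 G2]. split; [split|].
  - exact (ex_RInt_minus_R _ _ _ _ F1 G1).
  - exact (ex_RInt_minus_R _ _ _ _ F2 G2).
  - unfold CInt. apply injective_projections.
    + exact (RInt_minus_R _ _ _ _ F1 G1).
    + exact (RInt_minus_R _ _ _ _ F2 G2).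
Qed.

Lemma RInt_scal_R (k : R) (f : R -> R) a b : ex_RInt f a b ->
  ex_RInt (fun t => k * f t) a b /\ RInt (fun t => k * f t) a b = k * RInt f a b.
Proof.
  intros H. split.
  - exact (ex_RInt_scal (V := R_NormedModule) f a b k H).
  - exact (RInt_scal (V := R_CompleteNormedModule) f a b k H).
Qed.

Lemma CInt_mult (k : C) (f : R -> C) : ex_CInt f ->
  ex_CInt (fun t => k * f t)%C /\ CInt (fun t => k * f t)%C = (k * CInt f)%C.
Proof.
  intros [F1 F2]. destruct k as [a b].
  destruct (RInt_scal_R a _ _ _ F1) as [X1 E1], (RInt_scal_R b _ _ _ F1) as [X2 E2],
    (RInt_scal_R a _ _ _ F2) as [X3 E3], (RInt_scal_R b _ _ _ F2) as [X4 E4].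
  split; [split|].
  - exact (ex_RInt_minus_R _ _ _ _ X1 X4).
  - exact (ex_RInt_plus (V := R_NormedModule) _ _ _ _ X3 X2).
  - unfold CInt. apply injective_projections; simpl.
    + rewrite <- E1, <- E4. exact (RInt_minus_R _ _ _ _ X1 X4).
    + rewrite <- E3, <- E2. exact (RInt_plus (V := R_CompleteNormedModule) _ _ _ _ X3 X2).
Qed.

(** The factor 2 is the price of estimating the two components separately; it is harmless for a
    quadratic remainder. *)
Lemma CInt_bound (f : R -> C) M : ex_CInt f -> (forall t, 0 <= t <= 1 -> Cmod (f t) <= M) ->
  Cmod (CInt f) <= 2 * M.
Proof.
  intros [F1 F2] H.
  assert (B1 : Rabs (RInt (fun t => Re (f t)) 0 1) <= (1 - 0) * M).
  { apply abs_RInt_le_const; trivial; [lra|]. intros t Ht.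
    eapply Rle_trans; [apply re_le_Cmod|now apply H]. }
  assert (B2 : Rabs (RInt (fun t => Im (f t)) 0 1) <= (1 - 0) * M).
  { apply abs_RInt_le_const; trivial; [lra|]. intros t Ht.
    eapply Rle_trans; [|now apply H].
    exact (Rle_trans _ _ _ (Rmax_r _ _) (Rmax_Cmod _)). }
  apply Cmod_le_2; unfold CInt; simpl; lra.
Qed.

(** Makes both components of [Cexpm1_quot z] continuous through [t = 0], hence integrable. *)
Lemma difference_quotient_continuous (f : R -> R) (d : R) :
  (forall t, ex_derive f t) -> f 0 = 0 -> is_derive f 0 d ->
  forall t, continuous (fun t => if Req_EM_T t 0 then d else f t / t) t.
Proof.
  intros Hf H0 Hd t. destruct (Req_EM_T t 0) as [->|Ht].
  - apply continuity_pt_filterlim, continuity_pt_locally. intros eps.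
    apply is_derive_Reals in Hd. destruct (Hd eps (cond_pos eps)) as [e He].
    exists e. intros u Hu.
    destruct (Req_EM_T 0 0) as [_|]; [|contradiction].
    destruct (Req_EM_T u 0) as [_|Hn]; [rewrite Rminus_diag, Rabs_R0; apply cond_pos|].
    specialize (He u Hn). rewrite Rplus_0_l, H0, Rminus_0_r in He. apply He.
    unfold ball in Hu; simpl in Hu; unfold AbsRing_ball, abs, minus, plus, opp in Hu; simpl in Hu.
    now rewrite Ropp_0, Rplus_0_r in Hu.
  - apply (continuous_ext_loc (T := R_UniformSpace) (U := R_UniformSpace) _ (fun t => f t / t)).
    + exists (mkposreal (Rabs t) (Rabs_pos_lt _ Ht)). intros u Hu.
      destruct (Req_EM_T u 0) as [->|]; trivial. exfalso.
      unfold ball in Hu; simpl in Hu; unfold AbsRing_ball, abs, minus, plus, opp in Hu; simpl in Hu.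
      rewrite Rplus_0_l, Rabs_Ropp in Hu. lra.
    + apply (ex_derive_continuous (V := R_NormedModule)).
      apply ex_derive_div; [apply Hf|apply ex_derive_id|exact Ht].
Qed.

Lemma is_derive_curve_Cexp z t :
  is_derive (fun t => Re (Cexp (RtoC t * z)) - 1) t (Re (z * Cexp (RtoC t * z))) /\
  is_derive (fun t => Im (Cexp (RtoC t * z))) t (Im (z * Cexp (RtoC t * z))).
Proof.
  destruct (curve_derive_Cexp_ray z t) as [D1 D2]. split; [|exact D2].
  replace (Re (z * Cexp (RtoC t * z))) with (Re (z * Cexp (RtoC t * z)) - 0) by ring.
  apply (is_derive_minus (K := R_AbsRing) (V := R_NormedModule)); [exact D1|].
  apply (is_derive_const (K := R_AbsRing) (V := R_NormedModule)).
Qed.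

Definition Cexpm1_quot (z : C) (t : R) : C :=
  if Req_EM_T t 0 then z else ((Cexp (RtoC t * z) - 1) / RtoC t)%C.

(** The holomorphic extension of [Ein], as the integral of [(exp (t z) - 1) / t] over [[0, 1]]. *)
Definition CEin (z : C) : C := CInt (Cexpm1_quot z).

Definition CEin' (z : C) : C := CInt (fun t => Cexp (RtoC t * z)).

Lemma Cdiv_RtoC (a b t : R) : t <> 0 -> ((a, b) / RtoC t)%C = (a / t, b / t).
Proof.
  intros Ht. unfold Cdiv, Cinv, Cmult, RtoC; simpl. f_equal; field; trivial.
Qed.

Lemma ex_CInt_Cexpm1_quot z : ex_CInt (Cexpm1_quot z).
Proof.
  assert (E : forall t, Cexpm1_quot z t =
    (if Req_EM_T t 0 then Re z else (Re (Cexp (RtoC t * z)) - 1) / t,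
     if Req_EM_T t 0 then Im z else Im (Cexp (RtoC t * z)) / t)).
  { intros t. unfold Cexpm1_quot. destruct (Req_EM_T t 0) as [->|Ht]; [now destruct z|].
    rewrite <- Cdiv_RtoC by trivial. f_equal. unfold Cminus, Cplus, Copp, RtoC; simpl.
    f_equal; ring. }
  assert (D0 := is_derive_curve_Cexp z 0). rewrite Cmult_0_l, Cexp_0, Cmult_1_r in D0.
  split; (eapply ex_RInt_ext; [intros t _; symmetry; rewrite E; simpl; reflexivity|]);
    apply (ex_RInt_continuous (V := R_CompleteNormedModule)); intros t _.
  - apply (difference_quotient_continuous (fun t => Re (Cexp (RtoC t * z)) - 1)).
    + intros u. eexists. exact (proj1 (is_derive_curve_Cexp z u)).
    + rewrite Cmult_0_l, Cexp_0. simpl; ring.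
    + apply D0.
  - apply (difference_quotient_continuous (fun t => Im (Cexp (RtoC t * z)))).
    + intros u. eexists. exact (proj2 (is_derive_curve_Cexp z u)).
    + rewrite Cmult_0_l, Cexp_0. reflexivity.
    + apply D0.
Qed.

Lemma ex_CInt_Cexp z : ex_CInt (fun t => Cexp (RtoC t * z)).
Proof.
  split; apply (ex_RInt_continuous (V := R_CompleteNormedModule)); intros t _;
    apply (ex_derive_continuous (V := R_NormedModule)); eexists.
  - exact (proj1 (curve_derive_Cexp_ray z t)).
  - exact (proj2 (curve_derive_Cexp_ray z t)).
Qed.

(** [z exp (t z)] is the derivative of [exp (t z)] in [t]. *)
Lemma CEin'_mult z : (z * CEin' z)%C = (Cexp z - 1)%C.
Proof.
  unfold CEin'. rewrite <- (proj2 (CInt_mult z _ (ex_CInt_Cexp z))). unfold CInt.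
  assert (Hc : forall t, ex_derive (fun t => Re (z * Cexp (RtoC t * z))) t /\
    ex_derive (fun t => Im (z * Cexp (RtoC t * z))) t).
  { intros t. destruct z as [x y]. unfold Cexp. split; simpl; auto_derive; trivial. }
  apply injective_projections.
  - change (RInt (fun t => Re (z * Cexp (RtoC t * z))) 0 1 = Re (Cexp z) + - (1)).
    apply is_RInt_unique. replace (Re (Cexp z) + - (1)) with
      (minus (Re (Cexp (RtoC 1 * z))) (Re (Cexp (RtoC 0 * z)))).
    2:{ rewrite Cmult_1_l, Cmult_0_l, Cexp_0. reflexivity. }
    apply (is_RInt_derive (V := R_CompleteNormedModule) (fun t => Re (Cexp (RtoC t * z)))).
    + intros t _. exact (proj1 (curve_derive_Cexp_ray z t)).
    + intros t _. apply (ex_derive_continuous (V := R_NormedModule)). exact (proj1 (Hc t)).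
  - change (RInt (fun t => Im (z * Cexp (RtoC t * z))) 0 1 = Im (Cexp z) + - 0).
    apply is_RInt_unique. replace (Im (Cexp z) + - 0) with
      (minus (Im (Cexp (RtoC 1 * z))) (Im (Cexp (RtoC 0 * z)))).
    2:{ rewrite Cmult_1_l, Cmult_0_l, Cexp_0. reflexivity. }
    apply (is_RInt_derive (V := R_CompleteNormedModule) (fun t => Im (Cexp (RtoC t * z)))).
    + intros t _. exact (proj2 (curve_derive_Cexp_ray z t)).
    + intros t _. apply (ex_derive_continuous (V := R_NormedModule)). exact (proj2 (Hc t)).
Qed.

(** Differentiation under the integral sign: the integrand's remainder is
    [exp (t z) (exp (t h) - 1 - t h) / t], of modulus at most [3 exp |z| |h|^2] for every [t] in
    [[0, 1]]. The constant [k] doubles this through [CInt_bound]. *)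
Lemma is_C_derive_CEin z : is_C_derive CEin z (CEin' z).
Proof.
  set (k := 6 * exp (Cmod z)).
  assert (Hk : 0 < k) by (unfold k; assert (H := exp_pos (Cmod z)); lra).
  assert (Hq : forall h, Cmod h <= 1 ->
    Cmod (CEin (z + h) - CEin z - h * CEin' z) <= k * Cmod h ^ 2).
  { intros h Hh. assert (H0 := Cmod_ge_0 h).
    unfold CEin, CEin'. destruct (CInt_mult h _ (ex_CInt_Cexp z)) as [X1 <-].
    destruct (CInt_minus _ _ (ex_CInt_Cexpm1_quot (z + h)) (ex_CInt_Cexpm1_quot z)) as [X2 <-].
    destruct (CInt_minus _ _ X2 X1) as [X3 <-].
    replace (k * Cmod h ^ 2) with (2 * (exp (Cmod z) * (3 * Cmod h ^ 2))) by (unfold k; ring).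
    apply CInt_bound; trivial. intros t Ht.
    assert (Hpos : 0 < exp (Cmod z)) by apply exp_pos.
    unfold Cexpm1_quot. destruct (Req_EM_T t 0) as [->|Hn].
    - rewrite Cmult_0_l, Cexp_0. replace (z + h - z - h * 1)%C with (RtoC 0) by ring.
      rewrite Cmod_0. apply Rmult_le_pos; [lra|]. simpl; nra.
    - assert (HtC : RtoC t <> RtoC 0) by (intros E; apply RtoC_inj in E; contradiction).
      replace (RtoC t * (z + h))%C with (RtoC t * z + RtoC t * h)%C by ring.
      rewrite Cexp_plus.
      set (e := Cexp (RtoC t * z)). set (f := Cexp (RtoC t * h)).
      replace ((e * f - 1) / RtoC t - (e - 1) / RtoC t - h * e)%C
        with (e * (f - 1 - RtoC t * h) / RtoC t)%C by (field; exact HtC).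
      rewrite Cmod_div, Cmod_mult, Cmod_R, Rabs_pos_eq by (exact HtC || lra).
      apply Rle_div_l; [lra|]. rewrite Rmult_assoc.
      assert (Hth : Cmod (RtoC t * h) = t * Cmod h)
        by (rewrite Cmod_mult, Cmod_R, Rabs_pos_eq; lra).
      assert (Hf := Cmod_Cexp_remainder_le (RtoC t * h)). rewrite Hth in Hf.
      apply Rmult_le_compat; try apply Cmod_ge_0.
      + unfold e. rewrite Cmod_Cexp.
        assert (Hre : Re (RtoC t * z) <= Cmod z).
        { eapply Rle_trans; [apply Rle_abs|]. eapply Rle_trans; [apply re_le_Cmod|].
          rewrite Cmod_mult, Cmod_R, Rabs_pos_eq by lra. assert (Hz := Cmod_ge_0 z). nra. }
        destruct Hre as [Hre|Hre]; [left; now apply exp_increasing|right; now rewrite Hre].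
      + eapply Rle_trans; [apply Hf; nra|].
        replace (3 * (t * Cmod h) ^ 2) with (3 * Cmod h ^ 2 * t * t) by ring.
        assert (0 <= 3 * Cmod h ^ 2 * t) by (apply Rmult_le_pos; [simpl; nra|lra]). nra. }
  apply is_C_derive_eps. intros eps Heps. exists (Rmin 1 (eps / k)). split.
  { apply Rmin_pos; [lra|now apply Rdiv_lt_0_compat]. }
  intros y Hy. assert (Hy1 := Rlt_le_trans _ _ _ Hy (Rmin_l _ _)).
  assert (Hy2 := Rlt_le_trans _ _ _ Hy (Rmin_r _ _)).
  specialize (Hq (y - z)%C (Rlt_le _ _ Hy1)).
  replace (z + (y - z))%C with y in Hq by ring. eapply Rle_trans; [exact Hq|].
  assert (H0 := Cmod_ge_0 (y - z)). apply <- Rlt_div_r in Hy2; trivial. simpl. nra.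
Qed.

Lemma CEin_RtoC r : CEin (RtoC r) = RtoC (Ein r).
Proof.
  assert (E : forall t, Cexpm1_quot (RtoC r) t = RtoC (r * expm1_quot (t * r))).
  { intros t. unfold Cexpm1_quot. destruct (Req_EM_T t 0) as [->|Ht].
    - rewrite Rmult_0_l, expm1_quot_0. now rewrite Rmult_1_r.
    - rewrite <- RtoC_mult, Cexp_RtoC, <- RtoC_minus, <- RtoC_div by trivial. f_equal.
      rewrite <- expm1_quot_mult. field. exact Ht. }
  unfold CEin. rewrite (CInt_ext _ _ E). unfold CInt, RtoC. simpl. f_equal.
  - apply is_RInt_unique.
    replace (Ein r) with (minus (Ein (1 * r)) (Ein (0 * r))).
    2:{ rewrite Rmult_1_l, Rmult_0_l, Ein_0. apply Rminus_0_r. }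
    apply (is_RInt_derive (V := R_CompleteNormedModule) (fun t => Ein (t * r))).
    + intros t _. apply (is_derive_comp Ein (fun t => t * r)).
      * apply is_derive_Ein.
      * auto_derive; trivial. ring.
    + intros t _. apply (continuous_mult (K := R_AbsRing) (fun _ => r)).
      * apply continuous_const.
      * apply (continuous_comp (fun t => t * r) expm1_quot).
        -- apply (ex_derive_continuous (V := R_NormedModule)). auto_derive; trivial.
        -- apply continuity_pt_filterlim, expm1_quot_continuous.
  - rewrite RInt_const_R. apply Rmult_0_r.
Qed.

Lemma CEin_0 : CEin (RtoC 0) = RtoC 0.
Proof. now rewrite CEin_RtoC, Ein_0. Qed.

Lemma Cmod_CEin_le z : in_D z -> Cmod (CEin z) <= Ein (Cmod z).
Proof.
  intros Hz. assert (H := Ein_bound 1 CEin CEin' Rlt_0_1).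
  replace (CEin z) with (CEin z - CEin (RtoC 0))%C by (rewrite CEin_0; ring).
  replace (Ein (Cmod z)) with (Ein (Cmod z) / 1) by field.
  apply H; trivial.
  - intros y _. apply is_C_derive_CEin.
  - intros y _. rewrite CEin'_mult, Rdiv_1_r. apply Cmod_Cexp_minus_1_le.
Qed.

Lemma Ein_near_1 y : y < Ein 1 -> exists r, 0 < r < 1 /\ y < Ein r.
Proof.
  intros Hy. assert (Hc : continuity_pt Ein 1).
  { apply continuity_pt_filterlim, (ex_derive_continuous (V := R_NormedModule)).
    eexists; apply is_derive_Ein. }
  rewrite continuity_pt_locally in Hc. assert (Hp : 0 < Ein 1 - y) by lra.
  destruct (Hc (mkposreal _ Hp)) as [d Hd]. assert (Hd0 := cond_pos d).
  set (r := Rmax (1 / 2) (1 - d / 2)).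
  assert (Hr : 1 / 2 <= r /\ 1 - d / 2 <= r) by (split; [apply Rmax_l|apply Rmax_r]).
  assert (Hr1 : r < 1) by (apply Rmax_lub_lt; lra).
  exists r. split; [lra|]. specialize (Hd r). simpl in Hd.
  apply Rabs_lt_between in Hd; [lra|]. apply Rabs_lt_between'. lra.
Qed.

Lemma subordinate_phi_Ne_real_lt p r x : subordinate p phi_Ne -> 0 < r < 1 ->
  p (RtoC r) = RtoC x -> x < 5 / 3.
Proof.
  intros (_ & _ & w & _ & _ & Hw & E) Hr Hx.
  assert (Hz : in_D (RtoC r)) by (unfold in_D; rewrite Cmod_R, Rabs_pos_eq; lra).
  apply (phi_Ne_real_lt (w (RtoC r))); [now apply Hw|]. now rewrite <- E.
Qed.

Lemma subordinate_phi_e_self f : (forall z, in_D z -> f z = phi_e z) -> subordinate f phi_e.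
Proof.
  intros H. assert (He : analytic_on_D phi_e).
  { intros z _. eexists. apply is_C_derive_Cexp. }
  split; [|split; [exact He|]].
  - intros z Hz. eexists. apply (is_C_derive_ext_near phi_e f z _ (1 - Cmod z)).
    + unfold in_D in Hz; lra.
    + intros y Hy. symmetry. apply H. assert (T := Cmod_le_minus_plus y z). unfold in_D; lra.
    + apply is_C_derive_Cexp.
  - exists (fun z => z). repeat split; trivial. intros z _. eexists; apply is_C_derive_id.
Qed.

Lemma is_C_derive_CEin_scaled b z :
  is_C_derive (fun z => CEin z * RtoC (/ b))%C z (CEin' z * RtoC (/ b))%C.
Proof.
  eapply is_C_derive_eq.
  - apply is_C_derive_mult; [apply is_C_derive_CEin|apply is_C_derive_const].
  - cbv beta. ring.
Qed.

Lemma scaled_CEin'_mult b z : b <> 0 ->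
  (1 + b * (z * (CEin' z * RtoC (/ b))))%C = phi_e z.
Proof.
  intros Hb. unfold phi_e. assert (H := CEin'_mult z).
  replace (RtoC b * (z * (CEin' z * RtoC (/ b))))%C with (z * CEin' z * (RtoC b * RtoC (/ b)))%C
    by ring.
  rewrite H, <- RtoC_mult, Rinv_r by trivial. ring.
Qed.

Lemma CEin_scaled_RtoC r b : (CEin (RtoC r) * RtoC (/ b))%C = RtoC (Ein r / b).
Proof. now rewrite CEin_RtoC, <- RtoC_mult. Qed.

Lemma sharp_a : sharp dsub_a beta_a.
Proof.
  intros b0 Hb0 Himp. assert (H1 := Ein_1_pos). assert (Ea := beta_a_Ein).
  (* [b0] may be negative; raising it to at least [beta_a / 2] keeps [b] positive and still below
     [beta_a]. *)
  set (b := Rmax b0 (beta_a / 2)).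
  assert (Hb : b0 <= b /\ beta_a / 2 <= b) by (split; [apply Rmax_l|apply Rmax_r]).
  assert (Hlt : b < beta_a) by (apply Rmax_lub_lt; lra).
  assert (Hbp : 0 < b) by lra.
  set (p := fun z => (1 + CEin z * RtoC (/ b))%C).
  assert (Hp : forall z, is_C_derive p z (CEin' z * RtoC (/ b))%C).
  { intros z. eapply is_C_derive_eq.
    - apply is_C_derive_plus; [apply is_C_derive_const|apply is_C_derive_CEin_scaled].
    - ring. }
  destruct (Ein_near_1 (2 / 3 * b)) as (r & Hr & HE); [lra|].
  assert (Hs : subordinate p phi_Ne).
  { apply (Himp p b); [|unfold p; rewrite CEin_0; ring|apply Hb|].
    - intros z _. eexists; apply Hp.
    - apply subordinate_phi_e_self. intros z _. rewrite (is_C_derive_unique _ _ _ (Hp z)).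
      apply scaled_CEin'_mult. lra. }
  assert (Hx := subordinate_phi_Ne_real_lt p r (1 + Ein r / b) Hs Hr).
  assert (2 / 3 < Ein r / b) by (apply -> Rlt_div_r; lra).
  enough (1 + Ein r / b < 5 / 3) by lra. apply Hx.
  unfold p. now rewrite CEin_scaled_RtoC, <- RtoC_plus.
Qed.

Lemma sharp_b : sharp dsub_b beta_b.
Proof.
  intros b0 Hb0 Himp. assert (H1 := Ein_1_pos). assert (H2 := ln_5_3_pos).
  assert (Eb := beta_b_Ein).
  assert (Hpos : 0 < beta_b) by (rewrite Eb; now apply Rdiv_lt_0_compat).
  set (b := Rmax b0 (beta_b / 2)).
  assert (Hb : b0 <= b /\ beta_b / 2 <= b) by (split; [apply Rmax_l|apply Rmax_r]).
  assert (Hlt : b < beta_b) by (apply Rmax_lub_lt; lra).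
  assert (Hbp : 0 < b) by lra.
  set (p := fun z => Cexp (CEin z * RtoC (/ b))%C).
  assert (Hp : forall z, is_C_derive p z (CEin' z * RtoC (/ b) * p z)%C).
  { intros z. apply (is_C_derive_comp Cexp); [apply is_C_derive_Cexp|apply is_C_derive_CEin_scaled]. }
  destruct (Ein_near_1 (ln (5 / 3) * b)) as (r & Hr & HE).
  { rewrite Eb in Hlt. apply <- Rlt_div_r in Hlt; lra. }
  assert (Hs : subordinate p phi_Ne).
  { apply (Himp p b); [| |apply Hb|split].
    - intros z _. eexists; apply Hp.
    - unfold p. rewrite CEin_0, Cmult_0_l. apply Cexp_0.
    - intros z _. apply Cexp_neq_0.
    - apply subordinate_phi_e_self. intros z _. rewrite (is_C_derive_unique _ _ _ (Hp z)).
      rewrite <- (scaled_CEin'_mult b z) by lra. field. apply Cexp_neq_0. }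
  assert (Hx := subordinate_phi_Ne_real_lt p r (exp (Ein r / b)) Hs Hr).
  assert (Hl : ln (5 / 3) < Ein r / b) by (apply -> Rlt_div_r; lra).
  apply exp_increasing in Hl. rewrite exp_ln in Hl by lra.
  enough (exp (Ein r / b) < 5 / 3) by lra. apply Hx.
  unfold p. now rewrite CEin_scaled_RtoC, Cexp_RtoC.
Qed.

Lemma sharp_c : sharp dsub_c beta_c.
Proof.
  intros b0 Hb0 Himp. assert (H1 := Ein_1_pos). assert (Ec := beta_c_Ein).
  (* [b > Ein 1] keeps [1 - CEin / b] free of zeros in the disk, and [2 Ein 1] is still below
     [beta_c = 5 / 2 Ein 1]. *)
  set (b := Rmax b0 (2 * Ein 1)).
  assert (Hb : b0 <= b /\ 2 * Ein 1 <= b) by (split; [apply Rmax_l|apply Rmax_r]).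
  assert (Hlt : b < beta_c) by (apply Rmax_lub_lt; lra).
  assert (Hbp : 0 < b) by lra.
  set (q := fun z => (1 - CEin z * RtoC (/ b))%C).
  set (p := fun z => (/ q z)%C).
  assert (Hq0 : forall z, in_D z -> q z <> RtoC 0).
  { intros z Hz. apply Cmod_gt_0. eapply Rlt_le_trans; [|apply Cmod_1_minus_ge].
    rewrite Cmod_mult, Cmod_R, Rabs_pos_eq by (left; now apply Rinv_0_lt_compat).
    assert (Hl := Ein_div_lt z 1 b Hz Rlt_0_1). assert (Hc := Cmod_CEin_le z Hz).
    assert (Hi : 0 < / b) by now apply Rinv_0_lt_compat. unfold Rdiv in Hl. nra. }
  assert (Hp : forall z, in_D z -> is_C_derive p z (CEin' z * RtoC (/ b) / q z ^ 2)%C).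
  { intros z Hz. eapply is_C_derive_eq.
    - apply is_C_derive_inv; [|now apply Hq0].
      apply is_C_derive_minus; [apply is_C_derive_const|apply is_C_derive_CEin_scaled].
    - unfold Cdiv. ring. }
  destruct (Ein_near_1 (2 / 5 * b)) as (r & Hr & HE); [lra|].
  assert (Hs : subordinate p phi_Ne).
  { apply (Himp p b); [| |apply Hb|split].
    - intros z Hz. eexists; now apply Hp.
    - unfold p, q. rewrite CEin_0. field.
    - intros z Hz E. apply (Hq0 z Hz).
      replace (q z) with (q z * q z * p z)%C by (unfold p; field; now apply Hq0).
      rewrite E. ring.
    - apply subordinate_phi_e_self. intros z Hz. rewrite (is_C_derive_unique _ _ _ (Hp z Hz)).
      rewrite <- (scaled_CEin'_mult b z) by lra. unfold p. field. now apply Hq0. }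
  assert (Hx := subordinate_phi_Ne_real_lt p r (/ (1 - Ein r / b)) Hs Hr).
  assert (Hl : 2 / 5 < Ein r / b) by (apply -> Rlt_div_r; lra).
  assert (Hu : Ein r / b < 1).
  { apply Rlt_div_l; trivial. assert (Ein r < Ein 1) by (apply Ein_lt; lra). lra. }
  enough (H : / (1 - Ein r / b) < 5 / 3).
  { apply (Rmult_lt_compat_r (1 - Ein r / b)) in H; [|lra]. rewrite Rinv_l in H by lra. lra. }
  apply Hx. unfold p, q. rewrite CEin_scaled_RtoC, <- RtoC_minus, <- RtoC_inv; trivial. lra.
Qed.

(** * Numerical values *)

Definition Ein_term (n : nat) : R := 1 / (INR (S n) * INR (fact (S n))).

Lemma Ein_term_S n : 0 < Ein_term n /\ Ein_term (S n) <= Ein_term n * (1 / 2).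
Proof.
  assert (H1 : 1 <= INR (S n)) by (rewrite S_INR; assert (H := pos_INR n); lra).
  assert (H2 := INR_fact_lt_0 (S n)). unfold Ein_term.
  change (fact (S (S n))) with (S (S n) * fact (S n))%nat. rewrite mult_INR, (S_INR (S n)).
  set (a := INR (S n)) in *. set (f := INR (fact (S n))) in *.
  assert (H3 : 0 < a * f) by (apply Rmult_lt_0_compat; lra). split.
  - apply Rdiv_lt_0_compat; lra.
  - replace (1 / (a * f) * (1 / 2)) with (1 / (2 * (a * f))) by (field; lra).
    apply Rmult_le_compat_l; [lra|]. apply Rinv_le_contravar; [lra|]. nra.
Qed.

Lemma Ein_term_geom n k : 0 <= Ein_term (n + k) <= Ein_term n * (1 / 2) ^ k.
Proof.
  split; [left; apply Ein_term_S|]. induction k as [|k IH].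
  - rewrite Nat.add_0_r. simpl; lra.
  - rewrite Nat.add_succ_r. assert (H := Ein_term_S (n + k)). simpl. lra.
Qed.

Lemma ex_series_Ein_term_geom n : ex_series (fun k => Ein_term n * (1 / 2) ^ k).
Proof.
  apply (ex_series_scal_l (K := R_AbsRing) (Ein_term n) (fun k => (1 / 2) ^ k)).
  apply ex_series_geom. rewrite Rabs_pos_eq; lra.
Qed.

(** Ten exact terms; the tail lies between 0 and twice the next term by the ratio [1 / 2], hence
    below [10^(-8)]. *)
Lemma Ein_1_bounds : 1.3179021 <= Ein 1 <= 1.3179022.
Proof.
  assert (Hex : ex_series Ein_term).
  { apply (ex_series_le (K := R_AbsRing) (V := R_CompleteNormedModule) Ein_term
      (fun k => Ein_term 0 * (1 / 2) ^ k)); [|apply ex_series_Ein_term_geom].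
    intros k. change (Rabs (Ein_term k) <= Ein_term 0 * (1 / 2) ^ k).
    assert (H := Ein_term_geom 0 k). simpl in H. rewrite Rabs_pos_eq; apply H. }
  rewrite Ein_1. change (1.3179021 <= Series Ein_term <= 1.3179022).
  rewrite (Series_incr_n Ein_term 10) by (trivial; lia).
  assert (Hrem : Series (fun k => Ein_term (10 + k)) <= Ein_term 10 * 2).
  { eapply Rle_trans; [apply (Series_le _ (fun k => Ein_term 10 * (1 / 2) ^ k))|].
    - intros k. apply Ein_term_geom.
    - apply ex_series_Ein_term_geom.
    - rewrite Series_scal_l, Series_geom by (rewrite Rabs_pos_eq; lra). right; field. }
  assert (Hrem0 : 0 <= Series (fun k => Ein_term (10 + k))).
  { rewrite <- (Rmult_0_l (Series (fun k => Ein_term (10 + k)))), <- Series_scal_l.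
    apply Series_le.
    - intros k. assert (H := Ein_term_geom 10 k). lra.
    - now apply (ex_series_incr_n Ein_term 10). }
  set (rem := Series (fun k => Ein_term (10 + k))) in *. clearbody rem.
  cbn [pred sum_f_R0]. unfold Ein_term in *.
  rewrite !fact_simpl, !mult_INR in *. change (INR (fact 0)) with 1 in *.
  rewrite !S_INR in *. change (INR 0) with 0 in *. lra.
Qed.

(** [5 / 3 = (1 + x) / (1 - x)] at [x = 1 / 4]. The odd series of [ln ((1 + x) / (1 - x))] cut after
    [x^13] leaves an error with derivative [2 x^14 / (1 - x^2)], and
    [2 / (1 - 1 / 16) = 32 / 15]. *)
Lemma ln_5_3_bounds : 0.5108256 <= ln (5 / 3) <= 0.51082564.
Proof.
  destruct (MVT_cor2
    (fun x => ln (1 + x) - ln (1 - x)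
       - 2 * (x + x ^ 3 / 3 + x ^ 5 / 5 + x ^ 7 / 7 + x ^ 9 / 9 + x ^ 11 / 11 + x ^ 13 / 13))
    (fun x => 2 * x ^ 14 / (1 - x ^ 2)) 0 (1 / 4)) as [c [E Hc]].
  - lra.
  - intros x Hx. apply is_derive_Reals. auto_derive; [repeat split; lra|].
    field. split; [|split]; nra.
  - replace (1 + 0) with 1 in E by ring. replace (1 - 0) with 1 in E by ring.
    rewrite ln_1 in E.
    assert (El : ln (5 / 3) = ln (1 + 1 / 4) - ln (1 - 1 / 4)).
    { replace (5 / 3) with ((1 + 1 / 4) / (1 - 1 / 4)) by field. apply ln_div; lra. }
    assert (Hn : 0 <= 2 * c ^ 14 / (1 - c ^ 2) <= 32 / 15 * (1 / 4) ^ 14).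
    { assert (H1 : c ^ 2 <= 1 / 16) by (simpl; nra).
      assert (H2 : 0 <= c ^ 14) by (apply pow_le; lra).
      assert (H3 : c ^ 14 <= (1 / 4) ^ 14) by (apply pow_incr; lra).
      split; [apply Rdiv_le_0_compat; lra|]. apply Rle_div_l; [lra|]. nra. }
    rewrite El. lra.
Qed.

Lemma beta_approximations :
  approx5 beta_a (197685 / 10 ^ 5) /\ approx5 beta_b (257995 / 10 ^ 5) /\
  approx5 beta_c (329476 / 10 ^ 5).
Proof.
  assert (HE := Ein_1_bounds). assert (HL := ln_5_3_bounds). unfold approx5.
  rewrite beta_a_Ein, beta_b_Ein, beta_c_Ein.
  split; [|split]; apply Rabs_le.
  - lra.
  (* [beta_b] is about 2.5799453, barely above the rounding threshold 2.579945; this dictates the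
     precision of the bounds on [Ein 1] and [ln (5 / 3)]. *)
  - assert (2579945 / 10 ^ 6 <= Ein 1 / ln (5 / 3)) by (apply -> Rle_div_r; lra).
    assert (Ein 1 / ln (5 / 3) <= 257995 / 10 ^ 5) by (apply <- Rle_div_l; lra). lra.
  - lra.
Qed.

Theorem theorem2p4 :
  (forall (p : C -> C) (beta : R),
     analytic_on_D p -> p (RtoC 0) = RtoC 1 ->
     (beta_a <= beta /\ dsub_a beta p) \/
     (beta_b <= beta /\ dsub_b beta p) \/
     (beta_c <= beta /\ dsub_c beta p) ->
     subordinate p phi_Ne) /\
  (sharp dsub_a beta_a /\ sharp dsub_b beta_b /\ sharp dsub_c beta_c) /\
  (approx5 beta_a (197685 / 10 ^ 5) /\ approx5 beta_b (257995 / 10 ^ 5) /\ approx5 beta_c (329476 / 10 ^ 5)).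
Proof.
  split; [|split].
  - intros p beta Hp Hp0 [[Hb Hs]|[[Hb Hs]|[Hb Hs]]].
    + exact (implication_a p beta Hp Hp0 Hb Hs).
    + exact (implication_b p beta Hp Hp0 Hb Hs).
    + exact (implication_c p beta Hp Hp0 Hb Hs).
  - exact (conj sharp_a (conj sharp_b sharp_c)).
  - exact beta_approximations.
Qed.
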